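(* Let $L^n=(M,L)$ be a Lagrange space, with metric tensor $g_{ij}=\frac12\frac{\partial^2L}{\partial y^i\partial y^j}$, Cartan two-form $\omega=\frac12 d\left(\frac{\partial L}{\partial y^i}dx^i\right)$, and canonic semispray $S=y^i\frac{\partial}{\partial x^i}-2G^i\frac{\partial}{\partial y^i}$, where $$G^i=\frac14 g^{ik}\left(\frac{\partial^2L}{\partial y^k\partial x^h}y^h-\frac{\partial L}{\partial x^k}\right).$$ Then the canonic nonlinear connection, i.e. the one with local coefficients $N^i_j=\frac{\partial G^i}{\partial y^j}$, is the unique nonlinear connection $N$ on $TM$ that satisfies both of the following conditions: 1) the horizontal subbundle $NTM$ is a Lagrangian subbundle of $TTM$, which means that $\omega(hX,hY)=0$ for all vector fields $X,Y$ on $TM$, where $h$ is the horizontal projector of $N$; 2) the metric tensor $g_{ij}$ is covariant constant with respect to the dynamical covariant derivative $\nabla$ induced by $(S,N)$, i.e. $\nabla g=0$.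
   Context: All objects are $C^\infty$ and the summation convention is used. $M$ is a real $n$-dimensional manifold and $(x^i,y^i)$ are the local coordinates on $TM$ induced by local coordinates $(x^i)$ on $M$. The vertical distribution is $V_uTM=\ker(\pi_{*,u})$, $\pi:TM\to M$, spanned by $\partial/\partial y^i$. A Lagrange space $L^n=(M,L)$ consists of $M$ and a regular Lagrangian $L:TM\to\mathbb{R}$, i.e. a function such that the matrix $g_{ij}=\frac12\frac{\partial^2L}{\partial y^i\partial y^j}$ has rank $n$ everywhere on $TM$; $(g^{ij})$ denotes its inverse. Regularity of $L$ is equivalent to $\omega$ being a symplectic form on $TM$. The canonic semispray $S$ is a globally defined vector field on $TM$; it corresponds to the Euler–Lagrange equations of $L$ written as $\frac{d^2x^i}{dt^2}+2G^i(x,\frac{dx}{dt})=0$. A nonlinear connection $N$ is an $n$-dimensional distribution $u\mapsto N_uTM$ on $TM$ with $T_uTM=N_uTM\oplus V_uTM$ for all $u$. The horizontal projector $h$ is the projector onto $N$ along the vertical distribution. The local coefficients $N^i_j(x,y)$ are defined by $h\left(\frac{\partial}{\partial x^i}\right)=\frac{\partial}{\partial x^i}-N^j_i\frac{\partial}{\partial y^j}$. The dynamical covariant derivative of the pair $(S,N)$ is the operator on vertical vector fields $\nabla\left(X^i\frac{\partial}{\partial y^i}\right)=\left(S(X^i)+X^jN^i_j\right)\frac{\partial}{\partial y^i}$, extended to $g$ (with $g(X^i\frac{\partial}{\partial y^i},Y^j\frac{\partial}{\partial y^j})=g_{ij}X^iY^j$) by $(\nabla g)(X,Y)=S(g(X,Y))-g(\nabla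 X,Y)-g(X,\nabla Y)$ for vertical $X,Y$; locally $(\nabla g)_{ij}=S(g_{ij})-g_{im}N^m_j-g_{mj}N^m_i$. *)

(* Defs.v *)
From mathcomp Require Import all_boot all_order all_algebra.
From mathcomp Require Import all_classical all_reals all_analysis.

Set Implicit Arguments.
Unset Strict Implicit.
Unset Printing Implicit Defensive.

Import Order.TTheory GRing.Theory Num.Theory.
Import numFieldNormedType.Exports.

Local Open Scope classical_set_scope.
Local Open Scope ring_scope.

(* C^oo on U, for U open and E finite-dimensional: every iterated directional
   derivative of f is (Frechet) differentiable at every point of U. *)
Definition smooth_on (R : realType) (E F : normedModType R) (U : set E)
    (f : E -> F) : Prop :=
  forall (s : seq E) (z : E), U z ->
    differentiable (foldr (fun v (g : E -> F) => fun x => 'D_v g x) f s) z.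

(* An atlas is raw data here; [smooth_manifold] states its axioms.
   Coordinates are total functions, meaningful on the chart domain only. *)
Record atlas (R : realType) (E : normedModType R) (P : Type) := Atlas {
  chart : Type ;
  chart_dom : chart -> set P ;
  chart_coord : chart -> P -> E }.

Section Atlas.
Context {R : realType} {E : normedModType R} {P : Type} (A : atlas E P).

Definition chart_image (a : chart A) : set E := chart_coord a @` chart_dom a.

(* f o (chart_coord a)^-1 on [chart_image a], and 0 elsewhere *)
Definition local_rep (F : normedModType R) (a : chart A) (f : P -> F) : E -> F :=
  fun z => xget 0 (f @` (chart_dom a `&` chart_coord a @^-1` [set z])).

Definition smooth_fun (F : normedModType R) (f : P -> F) : Prop :=
  forall a, smooth_on (chart_image a) (local_rep a f).

(* A tangent vector at p is the family of its components in all the charts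
   around p, which are related by the differentials of the coordinate changes.
   Components in the other charts are set to 0, so that equality of tangent
   vectors is equality of families; the linear structure is pointwise. *)
Definition tangent_space (p : P) : set (chart A -> E) :=
  [set v | (forall a, ~ chart_dom a p -> v a = 0) /\
    (forall a b, chart_dom a p -> chart_dom b p ->
       v b = 'd (local_rep a (chart_coord b)) (chart_coord a p) (v a))].

(* the tangent vector at p whose components in the chart a are z *)
Definition tangent_of_chart (a : chart A) (p : P) (z : E) : chart A -> E :=
  fun b => if `[< chart_dom b p >]
           then 'd (local_rep a (chart_coord b)) (chart_coord a p) z else 0.

Definition vector_field (X : P -> chart A -> E) : Prop :=
  (forall p, tangent_space p (X p)) /\
  (forall a, smooth_on (chart_image a) (local_rep a (X ^~ a))).

(* the derivative X(f), computed in the chart a *)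
Definition field_apply (X : P -> chart A -> E) (F : normedModType R)
    (a : chart A) (f : P -> F) (p : P) : F :=
  'd (local_rep a f) (chart_coord a p) (X p a).

(* k-dimensional smooth distribution: locally, the span of k smooth vector
   fields that are linearly independent at every point *)
Definition distribution (k : nat) (N : P -> set (chart A -> E)) : Prop :=
  forall a p, chart_dom a p ->
  exists (W : set E) (X : 'I_k -> E -> E),
    [/\ open W, W (chart_coord a p), forall i, smooth_on W (X i) &
      forall q, chart_dom a q -> W (chart_coord a q) ->
        (forall c : 'I_k -> R,
           \sum_i c i *: X i (chart_coord a q) = 0 -> forall i, c i = 0) /\
        N q = [set w | tangent_space q w /\
                 exists c : 'I_k -> R, w a = \sum_i c i *: X i (chart_coord a q)]].

End Atlas.

Arguments tangent_space {R E P} A p _.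

(* The clause on W says that chart_coord a is a homeomorphism from its domain
   onto its image. *)
Definition smooth_manifold (R : realType) (E : normedModType R)
    (M : topologicalType) (A : atlas E M) : Prop :=
  hausdorff_space M /\ @second_countable M /\
  (forall p : M, exists a : chart A, chart_dom a p) /\
  (forall a : chart A,
     [/\ open (chart_dom a), open (chart_image a),
         set_inj (chart_dom a) (chart_coord a) &
         forall W, W `<=` chart_dom a -> open W <-> open (chart_coord a @` W)]) /\
  (forall a b : chart A,
     smooth_on (chart_coord a @` (chart_dom a `&` chart_dom b))
               (local_rep a (chart_coord b))).

Section TangentBundle.
Context {R : realType} {E : normedModType R} {P : Type} (A : atlas E P).

Record tangent_bundle := TangentBundle {
  tb_proj : P ;
  tb_vec : chart A -> E ;
  tb_vecP : tangent_space A tb_proj tb_vec }.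

Definition tangent_atlas : atlas (E * E)%type tangent_bundle :=
  {| chart := chart A ;
     chart_dom := fun a => [set u | chart_dom a (tb_proj u)] ;
     chart_coord := fun a u => (chart_coord a (tb_proj u), tb_vec u a) |}.

(* the kernel of the differential at u of the projection *)
Definition vertical_space (u : tangent_bundle) : set (chart tangent_atlas -> (E * E)%type) :=
  [set w | tangent_space tangent_atlas u w /\
     forall (a : chart tangent_atlas) (b : chart A),
       chart_dom a u -> chart_dom b (tb_proj u) ->
       'd (local_rep a (chart_coord b \o tb_proj)) (chart_coord a u) (w a) = 0].

Definition vertical_field (X : tangent_bundle -> chart tangent_atlas -> (E * E)%type) : Prop :=
  vector_field X /\ forall u, vertical_space u (X u).

End TangentBundle.

(* Coordinate expressions: l is L read in a chart of TM, z = (x, y). *)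
Section LocalFormulas.
Context {R : realType} {n : nat}.
Local Notation V := ('rV[R]_n * 'rV[R]_n)%type.

Definition ex (i : 'I_n) : V := (delta_mx 0 i, 0).
Definition ey (i : 'I_n) : V := (0, delta_mx 0 i).
Definition pdx (i : 'I_n) (f : V -> R) : V -> R := fun z => 'D_(ex i) f z.
Definition pdy (i : 'I_n) (f : V -> R) : V -> R := fun z => 'D_(ey i) f z.

Definition metric (l : V -> R) (z : V) : 'M[R]_n :=
  \matrix_(i, j) (2^-1 * pdy i (pdy j l) z).

(* G^i, where d^2L/dy^k dx^h is read as d/dy^k (d/dx^h L) *)
Definition spray_coef (l : V -> R) (i : 'I_n) (z : V) : R :=
  4^-1 * \sum_k invmx (metric l z) i k *
    (\sum_h pdy k (pdx h l) z * z.2 0 h - pdx k l z).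

(* the one-form (dL/dy^i) dx^i *)
Definition cartan_one_form (l : V -> R) (z v : V) : R :=
  \sum_i pdy i l z * v.1 0 i.

(* exterior derivative of a one-form, with the convention
   d theta (X, Y) = X (theta Y) - Y (theta X) - theta [X, Y] *)
Definition ext_deriv (theta : V -> V -> R) (z v w : V) : R :=
  'D_v (theta^~ w) z - 'D_w (theta^~ v) z.

Definition cartan_two_form (l : V -> R) (z v w : V) : R :=
  2^-1 * ext_deriv (cartan_one_form l) z v w.

End LocalFormulas.

Section Lagrange.
Context {R : realType} {n : nat} {P : Type} {A : atlas 'rV[R]_n P}.
Local Notation V := ('rV[R]_n * 'rV[R]_n)%type.
Local Notation TM := (tangent_bundle A).
Local Notation TA := (tangent_atlas A).

Local Notation field := (TM -> chart TA -> V).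

Variable L : TM -> R.

Definition lagrange_space : Prop :=
  smooth_fun TA L /\
  forall (a : chart TA) u, chart_dom a u ->
    \rank (metric (local_rep a L) (chart_coord a u)) = n.

(* S = y^i d/dx^i - 2 G^i d/dy^i *)
Definition canonic_semispray : field := fun u a =>
  if `[< chart_dom a u >]
  then (tb_vec u a,
        - 2 *: \row_i spray_coef (local_rep a L) i (chart_coord a u))
  else 0.

Definition nonlinear_connection (N : TM -> set (chart TA -> V)) : Prop :=
  distribution (A := TA) n N /\
  forall u w, tangent_space TA u w ->
    exists! hv : (chart TA -> V) * (chart TA -> V),
      [/\ N u hv.1, vertical_space u hv.2 & w = hv.1 + hv.2].

Variable N : TM -> set (chart TA -> V).

Definition horizontal_proj (u : TM) (w : chart TA -> V) : chart TA -> V :=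
  xget 0 [set h | N u h /\ vertical_space u (w - h)].

(* N^i_j, from h(d/dx^j) = d/dx^j - N^i_j d/dy^i *)
Definition conn_coef (a : chart TA) (i j : 'I_n) (u : TM) : R :=
  - (horizontal_proj u (tangent_of_chart a u (ex j)) a).2 0 i.

Definition canonic_connection : Prop :=
  nonlinear_connection N /\
  forall (a : chart TA) u, chart_dom a u -> forall i j,
    conn_coef a i j u =
    pdy j (spray_coef (local_rep a L) i) (chart_coord a u).

Definition lagrangian_horizontal : Prop :=
  forall X Y : field, vector_field X -> vector_field Y ->
  forall (a : chart TA) u, chart_dom a u ->
    cartan_two_form (local_rep a L) (chart_coord a u)
      (horizontal_proj u (X u) a) (horizontal_proj u (Y u) a) = 0.

(* X^i, for X = X^i d/dy^i in the chart a *)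
Definition vcomp (X : field) (a : chart TA) (i : 'I_n) : TM -> R :=
  fun u => (X u a).2 0 i.

Definition dyn_cov_deriv (X : field) : field := fun u a =>
  if `[< chart_dom a u >]
  then (0, \row_i (field_apply canonic_semispray a (vcomp X a i) u +
                   \sum_j vcomp X a j u * conn_coef a i j u))
  else 0.

(* g(X, Y) for vertical X and Y, read in the chart a *)
Definition metric_apply (a : chart TA) (X Y : field) : TM -> R := fun u =>
  \sum_i \sum_j metric (local_rep a L) (chart_coord a u) i j *
    vcomp X a i u * vcomp Y a j u.

Definition nabla_metric (a : chart TA) (X Y : field) (u : TM) : R :=
  field_apply canonic_semispray a (metric_apply a X Y) u
  - metric_apply a (dyn_cov_deriv X) Y u - metric_apply a X (dyn_cov_deriv Y) u.

Definition metric_parallel : Prop :=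
  forall X Y : field, vertical_field X -> vertical_field Y ->
  forall (a : chart TA) u, chart_dom a u -> nabla_metric a X Y u = 0.

End Lagrange.

(* Main.v *)
Require Import Defs.
From mathcomp Require Import all_boot all_order all_algebra.
From mathcomp Require Import all_classical all_reals all_analysis.
From mathcomp Require Import ring lra.

(** In a chart of the tangent bundle a connection is a matrix N of functions, its
    horizontal vectors being those of components (e, -N e). Let g be the metric
    tensor of L and write g N for the product of matrices. Evaluating the Cartan
    form on horizontal vectors and the covariant derivative of g on vertical ones
    turns the two conditions into
      (1)  (d^2 L/dy^k dx^j - d^2 L/dy^j dx^k)  =  2 ((g N)_kj - (g N)_jk),
      (2)  S(g_kj)  =  (g N)_kj + (g N)_jk.
    They prescribe the antisymmetric and the symmetric part of g N. As g is
    invertible, at most one matrix N satisfies both (connection_matrix_unique),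
    and a connection is determined by its coefficients (connectionE).

    That N = dG/dy satisfies them comes from the equation that defines the spray,
      4 g_km G^m  =  d^2 L/dy^k dx^h y^h - dL/dx^k.
    Its derivative with respect to y^j expresses 4 g N in terms of derivatives of
    L (metric_canonicE); its antisymmetric part is (1), and its symmetric part is
    (2), because the second and third derivatives of L do not depend on the order
    of differentiation (derive_commute).

    The two conditions quantify over vector fields defined on the whole tangent
    bundle, while (1) and (2) are pointwise. To pass from the former to the latter
    one needs fields with a prescribed value at a point (exists_vector_field).
    They are cut off by bump functions, which extend by zero because M is
    Hausdorff.

    The existence of the canonic connection means that the matrices dG/dy given by
    the various charts define the same horizontal space. The vertical components
    -2 G of the semispray are the only accelerations at which the Euler-Lagrange
    covector vanishes. This covector does not depend on the chart
    (euler_lagrange_covariant), which gives the transformation law of G;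
    differentiated along the fibres it becomes that of dG/dy
    (canonic_covariant), and this is the law of change of the components of
    horizontal vectors (canonic_space_chart). *)

Set Implicit Arguments.
Unset Strict Implicit.
Unset Printing Implicit Defensive.

Import Order.TTheory GRing.Theory Num.Theory.
Import numFieldNormedType.Exports.

Local Open Scope classical_set_scope.
Local Open Scope ring_scope.

(** * Rules for directional derivatives *)

Lemma near_open (T : topologicalType) (U : set T) (z : T) (Q : T -> Prop) :
  open U -> U z -> (forall x, U x -> Q x) -> \forall x \near z, Q x.
Proof. by move=> oU Uz UQ; apply: filterS (open_nbhs_nbhs (conj oU Uz)) => x /UQ. Qed.

Section DifferentialRules.
Context {R : realType}.
Implicit Types E F G : normedModType R.

(** Differentiability and the value of one directional derivative travel
    together, so that the rules below compose without side conditions. *)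
Definition has_deriv E F (f : E -> F) (z v : E) (d : F) : Prop :=
  differentiable f z /\ 'D_v f z = d.

(** The differential of f, being characterised by an asymptotic expansion at z,
    is also a differential of g; uniqueness identifies the two. *)
Lemma differentiable_near E F (f g : E -> F) (z : E) :
  {near z, f =1 g} -> differentiable f z -> differentiable g z.
Proof.
move=> fg df.
have [cdf fE] := (diff_locallyP _ _).1 df.
have gE : g \o shift z = cst (g z) + 'd f z +o_ 0 id.
  apply/eqaddoP => e e0; move/eqaddoP: (fE) => /(_ e e0) fe.
  have fg0 : \forall h \near 0, f (h + z) = g (h + z).
    have : \near z, f z = g z by [].
    by rewrite (near_shift 0 z); apply: filterS => h /=; rewrite subr0.
  near=> h.
  have <- : (f \o shift z - (cst (f z) + 'd f z)) h =
            (g \o shift z - (cst (g z) + 'd f z)) h.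
    rewrite !fctE /= (nbhs_singleton fg); congr (_ - _).
    by near: h.
  by near: h.
by apply/diff_locallyP; rewrite (diff_unique cdf gE).
Unshelve. all: by end_near. Qed.

Lemma has_deriv_near E F (f g : E -> F) z v d :
  {near z, f =1 g} -> has_deriv f z v d -> has_deriv g z v d.
Proof.
move=> fg [df <-]; split; first exact: differentiable_near df.
by apply: near_eq_derive; near do apply/esym; apply: fg.
Unshelve. all: by end_near. Qed.

Lemma has_deriv_self E F (f : E -> F) z v :
  differentiable f z -> has_deriv f z v ('D_v f z).
Proof. by []. Qed.

Lemma has_deriv_eq E F (f : E -> F) z v d d' :
  has_deriv f z v d -> d = d' -> has_deriv f z v d'.
Proof. by move=> H <-. Qed.

Lemma has_deriv_cst E F (c : F) (z v : E) : has_deriv (fun=> c) z v 0.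
Proof. by split; [exact: differentiable_cst | rewrite derive_cst]. Qed.

Lemma has_deriv_id E (z v : E) : has_deriv (fun x => x) z v v.
Proof. by split; [exact: ex_diff | rewrite derive_id]. Qed.

Lemma has_derivD E F (f g : E -> F) z v a b :
  has_deriv f z v a -> has_deriv g z v b ->
  has_deriv (fun x => f x + g x) z v (a + b).
Proof.
move=> [df <-] [dg <-]; split; first exact: differentiableD.
by rewrite (deriveD (diff_derivable df) (diff_derivable dg)).
Qed.

Lemma has_derivN E F (f : E -> F) z v a :
  has_deriv f z v a -> has_deriv (fun x => - f x) z v (- a).
Proof.
move=> [df <-]; split; first exact: differentiableN.
by rewrite (deriveN (diff_derivable df)).
Qed.

Lemma has_derivB E F (f g : E -> F) z v a b :
  has_deriv f z v a -> has_deriv g z v b ->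
  has_deriv (fun x => f x - g x) z v (a - b).
Proof. by move=> fa /has_derivN; apply: has_derivD. Qed.

Lemma has_derivM E (f g : E -> R) z v a b :
  has_deriv f z v a -> has_deriv g z v b ->
  has_deriv (fun x => f x * g x) z v (a * g z + f z * b).
Proof.
move=> [df <-] [dg <-]; split; first exact: differentiableM.
rewrite (deriveM (diff_derivable df) (diff_derivable dg)) addrC.
by rewrite [_ *: 'D_v f z]mulrC.
Qed.

Lemma has_derivMl E (f : E -> R) z v a c :
  has_deriv f z v a -> has_deriv (fun x => c * f x) z v (c * a).
Proof.
by move=> fa; have := has_derivM (has_deriv_cst c z v) fa; rewrite mul0r add0r.
Qed.

Lemma has_derivV E (f : E -> R) z v a :
  f z != 0 -> has_deriv f z v a ->
  has_deriv (fun x => (f x)^-1) z v (- a * (f z)^-1 * (f z)^-1).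
Proof.
move=> fz [df <-]; split; first exact: differentiableV.
rewrite (deriveV fz (diff_derivable df)) expr2 invfM.
by rewrite /GRing.scale /= mulNr !mulNr mulrC mulrA.
Qed.

Lemma has_deriv_sum E F (I : Type) (r : seq I) (f : I -> E -> F) z v a :
  (forall i, has_deriv (f i) z v (a i)) ->
  has_deriv (fun x => \sum_(i <- r) f i x) z v (\sum_(i <- r) a i).
Proof.
move=> fa; elim: r => [|i r IH].
  rewrite big_nil; apply: has_deriv_near (has_deriv_cst 0 z v).
  by near=> x; rewrite big_nil.
rewrite big_cons; apply: has_deriv_near (has_derivD (fa i) IH).
by near=> x; rewrite big_cons.
Unshelve. all: by end_near. Qed.

Lemma has_deriv_lin E F (f : {linear E -> F}) z v :
  continuous f -> has_deriv f z v (f v).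
Proof.
move=> cf; have df : differentiable f z by exact: linear_differentiable.
by split=> //; rewrite deriveE // diff_lin.
Qed.

Lemma has_deriv_comp E F G (f : F -> G) (g : E -> F) z v w d :
  has_deriv g z v w -> has_deriv f (g z) w d ->
  has_deriv (fun x => f (g x)) z v d.
Proof.
move=> [dg <-] [df <-]; split; first exact: differentiable_comp.
rewrite (deriveE _ (differentiable_comp dg df)) diff_comp //=.
by rewrite -!deriveE.
Qed.

Lemma has_deriv_pair E F G (f : E -> F) (g : E -> G) z v a b :
  has_deriv f z v a -> has_deriv g z v b ->
  has_deriv (fun x => (f x, g x)) z v (a, b).
Proof.
move=> [df <-] [dg <-]; split; first exact: differentiable_pair.
by rewrite (deriveE _ (differentiable_pair df dg)) diff_pair // -!deriveE.
Qed.

Lemma has_derivZl E F (k : E -> R) (c : F) z v a :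
  has_deriv k z v a -> has_deriv (fun x => k x *: c) z v (a *: c).
Proof.
move=> [dk <-]; split; first exact: differentiableZl.
by rewrite (deriveE _ (differentiableZl _ dk)) diffZl // -deriveE.
Qed.

Lemma has_derivZr E F (k : R) (f : E -> F) z v a :
  has_deriv f z v a -> has_deriv (fun x => k *: f x) z v (k *: a).
Proof.
move=> [df <-]; split; first exact: differentiableZ.
by rewrite (deriveZ _ (diff_derivable df)).
Qed.

Lemma has_deriv_fst E F (z v : E * F) : has_deriv fst z v v.1.
Proof. by apply: (has_deriv_lin (f := fst)) => x; exact: cvg_fst. Qed.

Lemma has_deriv_snd E F (z v : E * F) : has_deriv snd z v v.2.
Proof. by apply: (has_deriv_lin (f := snd)) => x; exact: cvg_snd. Qed.

Lemma has_deriv_coord m n (z v : 'M[R]_(m, n)) i j :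
  has_deriv (fun x : 'M[R]_(m, n) => x i j) z v (v i j).
Proof.
have dc := differentiable_coord z i j; split=> //.
have := @derive_mx R _ m n id z v (@ex_derive _ _ _ _ _ _ _ (is_derive_id z v)).
by rewrite derive_id => {2}->; rewrite mxE.
Qed.

Lemma has_deriv_diff E F (f : E -> F) z v :
  differentiable f z -> has_deriv f z v ('d f z v).
Proof. by move=> df; split=> //; rewrite deriveE. Qed.

Lemma has_deriv_diffE E F (f : E -> F) z v d : has_deriv f z v d -> 'd f z v = d.
Proof. by move=> [df <-]; rewrite deriveE. Qed.

End DifferentialRules.

(** * Smooth functions on an open set *)

Section Smoothness.
Context {R : realType}.
Implicit Types E F G : normedModType R.

(** Closure of smooth functions under an operation goes by induction on the
    order of differentiability, because the derivative of a product or of a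
    composite involves the functions themselves at the lower order. *)
Fixpoint Ck E F (k : nat) (U : set E) (f : E -> F) : Prop :=
  (forall z, U z -> differentiable f z) /\
  (if k is k'.+1 then forall v, Ck k' U (fun x => 'D_v f x) else True).

Lemma Ck_differentiable E F k (U : set E) (f : E -> F) z :
  Ck k U f -> U z -> differentiable f z.
Proof. by case: k => [|k] [+ _] => /[apply]. Qed.

Lemma smooth_onP E F (U : set E) (f : E -> F) :
  smooth_on U f <-> forall k, Ck k U f.
Proof.
split=> [sf k|Cf s].
  elim: k f sf => [|k IH] f sf; first by split=> //; exact: (sf [::]).
  split=> [|v]; first exact: (sf [::]).
  by apply: IH => s z Uz; have := sf (rcons s v) z Uz; rewrite foldr_rcons.
have : Ck (size s) U f by exact: Cf.
elim/last_ind: s f {Cf} => [|s v IH] f.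
  by move=> Cf z Uz; exact: Ck_differentiable Cf Uz.
by rewrite size_rcons foldr_rcons => -[_ Cf]; exact: IH (Cf v).
Qed.

Lemma smooth_on_differentiable E F (U : set E) (f : E -> F) z :
  smooth_on U f -> U z -> differentiable f z.
Proof. by move=> sf; exact: (sf [::]). Qed.

Lemma smooth_on_derive E F (U : set E) (f : E -> F) v :
  smooth_on U f -> smooth_on U (fun x => 'D_v f x).
Proof. by move=> sf s z Uz; have := sf (rcons s v) z Uz; rewrite foldr_rcons. Qed.

Lemma smooth_on_local E F (U : set E) (f : E -> F) :
  (forall z, U z -> exists2 W, W z & smooth_on W f) -> smooth_on U f.
Proof. by move=> H s z /H[W Wz sf]; exact: sf. Qed.

Lemma smooth_on_sub E F (U W : set E) (f : E -> F) :
  W `<=` U -> smooth_on U f -> smooth_on W f.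
Proof. by move=> WU sf s z /WU; exact: sf. Qed.

Lemma Ck_pred E F k (U : set E) (f : E -> F) : Ck k.+1 U f -> Ck k U f.
Proof.
elim: k f => [|k IH] f [df Df]; first by [].
by split=> // v; exact: IH.
Qed.

Section OpenSet.
Variables (E : normedModType R) (U : set E).
Hypothesis oU : open U.

Lemma Ck_ext F k (f g : E -> F) : {in U, f =1 g} -> Ck k U f -> Ck k U g.
Proof.
elim: k f g => [|k IH] f g fg [df Df];
  have nfg z : U z -> {near z, f =1 g} by
    (move=> Uz; apply: filterS (open_nbhs_nbhs (conj oU Uz)) => x Ux;
     apply: fg; exact/mem_set).
  by split=> // z Uz; exact: differentiable_near (nfg z Uz) (df z Uz).
split=> [z Uz|v]; first exact: differentiable_near (nfg z Uz) (df z Uz).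
apply: IH (Df v) => z /set_mem Uz.
exact: near_eq_derive (nfg z Uz).
Qed.

Lemma smooth_on_ext F (f g : E -> F) :
  {in U, f =1 g} -> smooth_on U f -> smooth_on U g.
Proof. by move=> fg /smooth_onP sf; apply/smooth_onP => k; exact: Ck_ext (sf k). Qed.

(** Derivatives of f matter on U only, where they may be replaced by formulas. *)
Lemma Ck_step F k (f : E -> F) (D : E -> E -> F) :
  (forall v, forall z, U z -> has_deriv f z v (D v z)) ->
  (forall v, Ck k U (D v)) -> Ck k.+1 U f.
Proof.
move=> fD CD; split=> [z Uz|v]; first exact: (fD 0 z Uz).1.
by apply: Ck_ext (CD v) => z /set_mem Uz; rewrite (fD v z Uz).2.
Qed.

Lemma Ck_cst F k (c : F) : Ck k U (fun=> c).
Proof.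
elim: k c => [|k IH] c; first by split=> // z _; exact: differentiable_cst.
by apply: (@Ck_step _ _ _ (fun _ _ => 0)) => // v z _; exact: has_deriv_cst.
Qed.

Lemma CkD F k (f g : E -> F) : Ck k U f -> Ck k U g -> Ck k U (fun x => f x + g x).
Proof.
elim: k f g => [|k IH] f g [df Df] [dg Dg].
  by split=> // z Uz; apply: differentiableD; [exact: df | exact: dg].
apply: (@Ck_step _ _ _ (fun v x => 'D_v f x + 'D_v g x)) => [v z Uz|v].
  by apply: has_derivD; apply: has_deriv_self; [exact: df|exact: dg].
exact: IH (Df v) (Dg v).
Qed.

Lemma Ck_sum F k (I : Type) (r : seq I) (f : I -> E -> F) :
  (forall i, Ck k U (f i)) -> Ck k U (fun x => \sum_(i <- r) f i x).
Proof.
move=> Cf; elim: r => [|i r IH].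
  by apply: Ck_ext (Ck_cst k 0) => x _; rewrite big_nil.
by apply: Ck_ext (CkD (Cf i) IH) => x _; rewrite big_cons.
Qed.

Lemma CkM k (f g : E -> R) : Ck k U f -> Ck k U g -> Ck k U (fun x => f x * g x).
Proof.
elim: k f g => [|k IH] f g Cf Cg.
  have [df _] := Cf; have [dg _] := Cg.
  by split=> // z Uz; apply: differentiableM; [exact: df | exact: dg].
have [df Df] := Cf; have [dg Dg] := Cg.
apply: (@Ck_step _ _ _ (fun v x => 'D_v f x * g x + f x * 'D_v g x)) => [v z Uz|v].
  by apply: has_derivM; apply: has_deriv_self; [exact: df|exact: dg].
by apply: CkD; [exact: IH (Df v) (Ck_pred Cg)|exact: IH (Ck_pred Cf) (Dg v)].
Qed.

Lemma Ck_prod k (I : Type) (r : seq I) (f : I -> E -> R) :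
  (forall i, Ck k U (f i)) -> Ck k U (fun x => \prod_(i <- r) f i x).
Proof.
move=> Cf; elim: r => [|i r IH].
  by apply: Ck_ext (Ck_cst k (1 : R)) => x _; rewrite big_nil.
by apply: Ck_ext (CkM (Cf i) IH) => x _; rewrite big_cons.
Qed.

Lemma CkV k (f : E -> R) :
  (forall z, U z -> f z != 0) -> Ck k U f -> Ck k U (fun x => (f x)^-1).
Proof.
move=> f0; elim: k => [|k IH] Cf; have [df Df] := Cf.
  by split=> // z Uz; apply: differentiableV; [exact: df | exact: f0].
pose D v x := (-1 * 'D_v f x) * (f x)^-1 * (f x)^-1.
apply: (@Ck_step _ _ _ D) => [v z Uz|v].
  have := has_derivV (f0 z Uz) (has_deriv_self v (df z Uz)).
  by rewrite /D mulN1r.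
apply: CkM; last by apply: IH; exact: Ck_pred.
apply: CkM; last by apply: IH; exact: Ck_pred.
by apply: CkM; [exact: (Ck_cst k (-1 : R)) | exact: Df v].
Qed.

Lemma CkZl F k (f : E -> R) (c : F) : Ck k U f -> Ck k U (fun x => f x *: c).
Proof.
elim: k f => [|k IH] f [df Df].
  by split=> // z Uz; apply: differentiableZl; exact: df.
apply: (@Ck_step _ _ _ (fun v x => 'D_v f x *: c)) => [v z Uz|v].
  by apply: has_derivZl; apply: has_deriv_self; exact: df.
exact: IH (Df v).
Qed.

Lemma Ck_pair F G k (f : E -> F) (g : E -> G) :
  Ck k U f -> Ck k U g -> Ck k U (fun x => (f x, g x)).
Proof.
elim: k f g => [|k IH] f g [df Df] [dg Dg].
  by split=> // z Uz; apply: differentiable_pair; [exact: df | exact: dg].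
apply: (@Ck_step _ _ _ (fun v x => ('D_v f x, 'D_v g x))) => [v z Uz|v].
  by apply: has_deriv_pair; apply: has_deriv_self; [exact: df|exact: dg].
exact: IH (Df v) (Dg v).
Qed.

Lemma Ck_linr F G k (f : E -> F) (c : F -> G) :
  (forall y w, has_deriv c y w (c w)) -> Ck k U f -> Ck k U (fun x => c (f x)).
Proof.
move=> cD; elim: k f => [|k IH] f [df Df].
  by split=> // z Uz; apply: (has_deriv_comp (has_deriv_self 0 (df z Uz)) (cD _ _)).1.
apply: (@Ck_step _ _ _ (fun v x => c ('D_v f x))) => [v z Uz|v]; last exact: IH (Df v).
exact: has_deriv_comp (has_deriv_self v (df z Uz)) (cD _ _).
Qed.

Lemma Ck_id k : Ck k U (fun x => x).
Proof.
case: k => [|k]; first by split=> // z _; exact: (has_deriv_id z 0).1.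
by apply: (@Ck_step _ _ _ (fun v _ => v)) => [v z _|v]; [exact: has_deriv_id|exact: Ck_cst].
Qed.

(** A basis with its dual basis: finite dimension enters the chain rule for
    higher derivatives in this form. *)
Definition coordinates F (I : finType) (e : I -> F) (c : I -> F -> R) : Prop :=
  (forall i y w, has_deriv (c i) y w (c i w)) /\
  (forall y, y = \sum_i c i y *: e i).

(** Expanding the derivative of g on the basis gives
    D_v (f o g) = sum_i c_i (D_v g) (D_(e i) f o g),
    whose factors are one order less differentiable than f and g. *)
Lemma Ck_comp F (W : set F) (I : finType) (e : I -> F) (c : I -> F -> R) k
    (f : F -> R) (g : E -> F) :
  coordinates e c -> (forall z, U z -> W (g z)) ->
  Ck k W f -> Ck k U g -> Ck k U (fun x => f (g x)).
Proof.
move=> [cD ec] UW; elim: k f => [|k IH] f Cf Cg; have [df Df] := Cf; have [dg Dg] := Cg.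
  split=> // z Uz.
  exact: (has_deriv_comp (has_deriv_self 0 (dg z Uz)) (has_deriv_self _ (df _ (UW z Uz)))).1.
pose D v x := \sum_i c i ('D_v g x) * 'D_(e i) f (g x).
apply: (@Ck_step _ _ _ D) => [v z Uz|v].
  have dfz := df _ (UW z Uz).
  apply: has_deriv_comp (has_deriv_self v (dg z Uz)) _.
  apply: has_deriv_eq (has_deriv_diff _ dfz) _.
  rewrite {1}(ec ('D_v g z)) linear_sum; apply: eq_bigr => i _.
  rewrite (deriveE _ dfz); exact: linearZ.
apply: Ck_sum => i; apply: CkM; first exact: (Ck_linr (cD i) (Dg v)).
exact: IH (Df (e i)) (Ck_pred Cg).
Qed.

Lemma smooth_on_cst F (c : F) : smooth_on U (fun=> c).
Proof. by apply/smooth_onP => k; exact: Ck_cst. Qed.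

Lemma smooth_on_id : smooth_on U (fun x => x).
Proof. by apply/smooth_onP => k; exact: Ck_id. Qed.

Lemma smooth_onD F (f g : E -> F) :
  smooth_on U f -> smooth_on U g -> smooth_on U (fun x => f x + g x).
Proof. by move=> /smooth_onP sf /smooth_onP sg; apply/smooth_onP => k; exact: CkD. Qed.

Lemma smooth_on_sum F (I : Type) (r : seq I) (f : I -> E -> F) :
  (forall i, smooth_on U (f i)) -> smooth_on U (fun x => \sum_(i <- r) f i x).
Proof.
by move=> sf; apply/smooth_onP => k; apply: Ck_sum => i; move/smooth_onP: (sf i).
Qed.

Lemma smooth_onM (f g : E -> R) :
  smooth_on U f -> smooth_on U g -> smooth_on U (fun x => f x * g x).
Proof. by move=> /smooth_onP sf /smooth_onP sg; apply/smooth_onP => k; exact: CkM. Qed.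

Lemma smooth_onMl (c : R) (f : E -> R) :
  smooth_on U f -> smooth_on U (fun x => c * f x).
Proof. by apply: smooth_onM; exact: smooth_on_cst. Qed.

Lemma smooth_onN (f : E -> R) :
  smooth_on U f -> smooth_on U (fun x => - f x).
Proof.
by move/(smooth_onMl (-1)); apply: smooth_on_ext => x _; rewrite mulN1r.
Qed.

Lemma smooth_onB (f g : E -> R) :
  smooth_on U f -> smooth_on U g -> smooth_on U (fun x => f x - g x).
Proof. by move=> sf /smooth_onN; exact: smooth_onD. Qed.

Lemma smooth_on_prod (I : Type) (r : seq I) (f : I -> E -> R) :
  (forall i, smooth_on U (f i)) -> smooth_on U (fun x => \prod_(i <- r) f i x).
Proof.
by move=> sf; apply/smooth_onP => k; apply: Ck_prod => i; move/smooth_onP: (sf i).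
Qed.

Lemma smooth_onV (f : E -> R) : (forall z, U z -> f z != 0) ->
  smooth_on U f -> smooth_on U (fun x => (f x)^-1).
Proof. by move=> f0 /smooth_onP sf; apply/smooth_onP => k; exact: CkV. Qed.

Lemma smooth_onZl F (f : E -> R) (c : F) :
  smooth_on U f -> smooth_on U (fun x => f x *: c).
Proof. by move=> /smooth_onP sf; apply/smooth_onP => k; exact: CkZl. Qed.

Lemma smooth_on_pair F G (f : E -> F) (g : E -> G) :
  smooth_on U f -> smooth_on U g -> smooth_on U (fun x => (f x, g x)).
Proof. by move=> /smooth_onP sf /smooth_onP sg; apply/smooth_onP => k; exact: Ck_pair. Qed.

Lemma smooth_on_linr F G (f : E -> F) (c : F -> G) :
  (forall y w, has_deriv c y w (c w)) -> smooth_on U f ->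
  smooth_on U (fun x => c (f x)).
Proof. by move=> cD /smooth_onP sf; apply/smooth_onP => k; exact: Ck_linr. Qed.

Lemma smooth_on_coord m n (f : E -> 'M[R]_(m, n)) i j :
  smooth_on U f -> smooth_on U (fun x => f x i j).
Proof.
exact: (smooth_on_linr (c := fun y : 'M[R]_(m, n) => y i j)
         (fun y w => has_deriv_coord y w i j)).
Qed.

Lemma smooth_on_row n (f : 'I_n -> E -> R) :
  (forall i, smooth_on U (f i)) -> smooth_on U (fun x => \row_i f i x).
Proof.
move=> sf.
have := smooth_on_sum (index_enum 'I_n)
  (fun i => smooth_onZl (delta_mx 0 i : 'rV[R]_n) (sf i)).
apply: smooth_on_ext => x _; rewrite [RHS]row_sum_delta.
by apply: eq_bigr => i _; rewrite mxE.
Qed.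

Lemma smooth_on_comp F (W : set F) (I : finType) (e : I -> F) (c : I -> F -> R)
    (f : F -> R) (g : E -> F) :
  coordinates e c -> (forall z, U z -> W (g z)) ->
  smooth_on W f -> smooth_on U g -> smooth_on U (fun x => f (g x)).
Proof.
move=> ec UW /smooth_onP sf /smooth_onP sg; apply/smooth_onP => k.
exact: Ck_comp ec UW (sf k) (sg k).
Qed.

Lemma smooth_on_det n (f : E -> 'M[R]_n) :
  (forall i j, smooth_on U (fun x => f x i j)) -> smooth_on U (fun x => \det (f x)).
Proof.
move=> sf; apply: smooth_on_sum => s; apply: smooth_onMl.
by apply: smooth_on_prod => i.
Qed.

(** Cramer's rule. *)
Lemma smooth_on_invmx n (f : E -> 'M[R]_n) :
  (forall z, U z -> f z \in unitmx) ->
  (forall i j, smooth_on U (fun x => f x i j)) ->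
  forall i j, smooth_on U (fun x => invmx (f x) i j).
Proof.
move=> fu sf i j.
have : smooth_on U (fun x => (\det (f x))^-1 * cofactor (f x) j i).
  apply: smooth_onM.
    apply: smooth_onV (smooth_on_det sf) => z /fu.
    by rewrite unitmxE unitfE.
  apply: smooth_onMl; apply: smooth_on_det => p q.
  by apply: smooth_on_ext (sf (lift j p) (lift i q)) => x _; rewrite !mxE.
by apply: smooth_on_ext => x /set_mem /fu; rewrite /invmx => ->; rewrite !mxE.
Qed.

End OpenSet.

Lemma fst_sum E F (I : finType) (f : I -> E * F) : (\sum_i f i).1 = \sum_i (f i).1.
Proof. exact: (big_morph fst (id1 := 0) (op1 := +%R)). Qed.

Lemma snd_sum E F (I : finType) (f : I -> E * F) : (\sum_i f i).2 = \sum_i (f i).2.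
Proof. exact: (big_morph snd (id1 := 0) (op1 := +%R)). Qed.

Lemma coordinates_row n :
  coordinates (fun i : 'I_n => delta_mx 0 i : 'rV[R]_n) (fun i v => v 0 i).
Proof.
split=> [i y w|y]; first exact: has_deriv_coord.
exact: row_sum_delta.
Qed.

Lemma coordinates_pair_row n :
  coordinates (fun i : 'I_n + 'I_n => match i with inl j => ex j | inr j => ey j end
                 : 'rV[R]_n * 'rV[R]_n)
    (fun i v => match i with inl j => v.1 0 j | inr j => v.2 0 j end).
Proof.
split=> [[] i y w|[x y]].
- exact: has_deriv_comp (has_deriv_fst _ _) (has_deriv_coord _ _ _ _).
- exact: has_deriv_comp (has_deriv_snd _ _) (has_deriv_coord _ _ _ _).
rewrite big_sumType /=; apply: injective_projections => /=; rewrite ?fst_sum ?snd_sum /=.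
  rewrite [X in _ = _ + X]big1 ?addr0; first exact: row_sum_delta.
  by move=> i _; rewrite scaler0.
rewrite [X in _ = X + _]big1 ?add0r; first exact: row_sum_delta.
by move=> i _; rewrite scaler0.
Qed.

End Smoothness.

(** * Symmetry of second derivatives *)

Section Schwarz.
Context {R : realType} {E : normedModType R}.
Implicit Types (f : E -> R) (z v w : E).

(** The mean value theorem in the direction v turns the second difference into h
    times an increment of D_v f along h w, which differentiability of D_v f at z
    estimates. *)
Lemma second_difference f z v w (e : R) : 0 < e ->
  (\forall x \near z, differentiable f x) ->
  differentiable (fun x => 'D_v f x) z ->
  exists2 d, 0 < d & forall h, 0 < h -> h < d ->
    `|f (h *: v + h *: w + z) - f (h *: v + z) - f (h *: w + z) + f z
      - h * (h * 'D_w (fun x => 'D_v f x) z)| <= e * (h * h).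
Proof.
move=> e0 df dg; set g := fun x => 'D_v f x in dg *.
pose C := `|v| + `|w| + 1.
have C0 : 0 < C by rewrite /C ltr_wpDl// addr_ge0.
have e'0 : 0 < e / (2 * C) by rewrite divr_gt0// mulr_gt0.
have [_ gE] := (diff_locallyP _ _).1 dg.
have {gE} : \forall u \near 0, `|g (u + z) - g z - 'd g z u| <= e / (2 * C) * `|u|.
  move/eqaddoP: gE => /(_ _ e'0); apply: filterS => u /=.
  by rewrite !fctE /= opprD addrA.
have {df} : \forall u \near 0, differentiable f (u + z).
  by move: df; rewrite (near_shift 0 z); apply: filterS => u /=; rewrite subr0.
move=> dfu gu; have [r /= r0 Br] := (nbhs_ballP _ _).1 (filterI dfu gu).
exists (r / C); first by rewrite divr_gt0.
move=> h h0 hr.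
have hC : h * C < r by rewrite -ltr_pdivlMr.
have inB (s t : R) : 0 <= s -> s <= h -> 0 <= t -> t <= h -> `|s *: v + t *: w| <= h * C.
  move=> s0 sh t0 th; apply: le_trans (ler_normD _ _) _.
  rewrite !normrZ !ger0_norm// /C mulrDr mulr1 mulrDr.
  apply: le_trans (_ : h * `|v| + h * `|w| <= _); last by rewrite lerDl ltW.
  by apply: lerD; apply: ler_wpM2r.
have B s t : 0 <= s -> s <= h -> 0 <= t -> t <= h ->
    differentiable f (s *: v + t *: w + z) /\
    `|g (s *: v + t *: w + z) - g z - 'd g z (s *: v + t *: w)| <= e / (2 * C) * (h * C).
  move=> s0 sh t0 th; have nb := inB s t s0 sh t0 th.
  have [|d1 d2] := Br (s *: v + t *: w).
    by rewrite -ball_normE /= sub0r normrN (le_lt_trans nb).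
  by split=> //; apply: le_trans d2 _; rewrite ler_wpM2l// ltW.
have hd s t : 0 <= s -> s <= h -> 0 <= t -> t <= h ->
    has_deriv (fun s : R => f (s *: v + t *: w + z)) s 1 (g (s *: v + t *: w + z)).
  move=> s0 sh t0 th; have [dfs _] := B s t s0 sh t0 th.
  apply: (has_deriv_comp (g := fun s : R => s *: v + t *: w + z)) (has_deriv_self v dfs).
  apply: has_deriv_eq (has_derivD (has_derivD (has_derivZl v (has_deriv_id s 1))
    (has_deriv_cst _ _ _)) (has_deriv_cst _ _ _)) _.
  by rewrite scale1r !addr0.
(* 0 *: w is kept in phi so that both terms are instances of hd *)
pose phi s : R := f (s *: v + h *: w + z) - f (s *: v + 0 *: w + z).
pose dphi s : R := g (s *: v + h *: w + z) - g (s *: v + 0 *: w + z).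
have hphi s : 0 <= s -> s <= h -> has_deriv phi s 1 (dphi s).
  by move=> s0 sh; apply: has_derivB; apply: hd => //; exact: ltW.
have [c ch] : exists2 c, c \in `]0, h[%R & phi h - phi 0 = dphi c * (h - 0).
  apply: MVT => // [s|].
    rewrite in_itv /= => /andP[s0 sh].
    by have [d1 d2] := hphi s (ltW s0) (ltW sh); split=> //; exact: diff_derivable.
  apply: continuous_in_subspaceT => s /set_mem /=; rewrite in_itv /= => /andP[s0 sh].
  exact: differentiable_continuous (hphi s s0 sh).1.
rewrite subr0 /phi !scale0r !addr0 !add0r => phiE.
have -> : f (h *: v + h *: w + z) - f (h *: v + z) - f (h *: w + z) + f z
  = dphi c * h by rewrite -phiE; ring.
move: ch; rewrite in_itv /= => /andP[/ltW c0 /ltW ch].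
have -> : dphi c * h - h * (h * 'D_w g z) = h * (dphi c - h * 'D_w g z) by ring.
rewrite normrM gtr0_norm// [leRHS]mulrCA ler_pM2l//.
have [_ b1] := B c h c0 ch (ltW h0) (lexx h).
have [_ b2] := B c 0 c0 ch (lexx 0) (ltW h0).
have -> : dphi c - h * 'D_w g z =
  (g (c *: v + h *: w + z) - g z - 'd g z (c *: v + h *: w))
  - (g (c *: v + 0 *: w + z) - g z - 'd g z (c *: v + 0 *: w)).
  rewrite /dphi scale0r addr0 linearD (deriveE w dg).
  have -> : 'd g z (h *: w) = h * 'd g z w by exact: linearZ.
  by ring.
apply: le_trans (ler_normB _ _) _.
apply: le_trans (lerD b1 b2) _.
have -> : e / (2 * C) * (h * C) = e * h / 2 by field; rewrite gt_eqF.
by rewrite -splitr.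
Qed.

(** Both iterated derivatives are the limit of the same second difference
    quotient, which is symmetric in v and w. *)
Lemma derive_commute f z v w :
  (\forall x \near z, differentiable f x) ->
  differentiable (fun x => 'D_v f x) z -> differentiable (fun x => 'D_w f x) z ->
  'D_w (fun x => 'D_v f x) z = 'D_v (fun x => 'D_w f x) z.
Proof.
move=> df dv dw; apply/eqP; rewrite -subr_eq0 -normr_eq0 eq_le normr_ge0 andbT.
set A := 'D_w _ _; set B := 'D_v _ _.
apply/ler_addgt0Pr => e e0; rewrite add0r.
have e20 : 0 < e / 2 by rewrite divr_gt0.
have [d d0 Hd] := second_difference w e20 df dv.
have [d' d'0 Hd'] := second_difference v e20 df dw.
pose h := Num.min d d' / 2.
have m0 : 0 < Num.min d d' by rewrite lt_min d0.
have h0 : 0 < h by rewrite divr_gt0.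
have hm : h < Num.min d d' by rewrite /h ltr_pdivrMr// ltr_pMr// ltr1n.
have /andP[hd hd'] : (h < d) && (h < d') by rewrite -lt_min.
have := Hd h h0 hd; have := Hd' h h0 hd'.
rewrite -/A -/B [h *: w + h *: v]addrC; set X := f (_ + _ + _) => H1 H2.
rewrite -(ler_pM2l (_ : 0 < h * h)) ?mulr_gt0//.
have -> : h * h * `|A - B| = `|h * h * (A - B)|.
  by rewrite normrM (gtr0_norm (_ : 0 < h * h)) ?mulr_gt0.
have -> : h * h * (A - B) =
  (X - f (h *: w + z) - f (h *: v + z) + f z - h * (h * B))
  - (X - f (h *: v + z) - f (h *: w + z) + f z - h * (h * A)) by ring.
apply: le_trans (ler_normB _ _) _; apply: le_trans (lerD H1 H2) _.
by rewrite -mulrDl -splitr mulrC.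
Qed.

End Schwarz.

(** * Bump functions *)

Section FlatFunction.
Context {R : realType}.

(** The functions t^(-k) exp(-1/t), extended by zero to the negative half-line:
    a family closed under differentiation, which contains exp(-1/t). *)
Definition flat (k : nat) (t : R) : R :=
  if 0 < t then t^-1 ^+ k * expR (- t^-1) else 0.

Lemma flat_le0 k t : t <= 0 -> flat k t = 0.
Proof. by rewrite /flat ltNge => ->. Qed.

(** The exponential series bounds exp(1/t) from below by a multiple of
    (1/t)^(k + 2); the remaining factor t^2 makes the derivative at 0 vanish. *)
Lemma flat_le_sqr k (t : R) : 0 <= flat k t <= (k.+2)`!%:R * t ^+ 2.
Proof.
rewrite /flat; case: ifP => t0; last by rewrite lexx /= mulr_ge0 ?sqr_ge0.
have x0 : 0 < t^-1 by rewrite invr_gt0.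
apply/andP; split; first by rewrite mulr_ge0 ?expR_ge0// exprn_ge0// ltW.
have n0 : 0 < (k.+2)`!%:R :> R by rewrite ltr0n fact_gt0.
have e1 : t^-1 ^+ k.+2 / (k.+2)`!%:R <= expR t^-1.
  by apply: le_trans (expR_ge1Dxn k.+1 (ltW x0)); rewrite lerDr.
rewrite expRN ler_pdivrMr ?expR_gt0//.
apply: le_trans (_ : (k.+2)`!%:R * t ^+ 2 * (t^-1 ^+ k.+2 / (k.+2)`!%:R) <= _); last first.
  by rewrite ler_pM2l// mulr_gt0// exprn_gt0.
rewrite le_eqVlt; apply/orP; left; apply/eqP.
rewrite !exprS expr0; field.
by rewrite (lt0r_neq0 t0) (lt0r_neq0 n0).
Qed.

Lemma flat_deriv k (t : R) :
  has_deriv (flat k) t 1 (flat k.+2 t - k%:R * flat k.+1 t).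
Proof.
have [t0|t0|t0] := ltgtP t 0.
- rewrite !flat_le0 ?(ltW t0)// mulr0 subr0.
  apply: has_deriv_near (has_deriv_cst 0 t 1).
  near=> s; rewrite flat_le0//; apply/ltW; near: s; exact: lt_nbhsl.
- pose g (s : R) := s^-1 ^+ k * expR (- s^-1).
  apply: (@has_deriv_near _ _ _ g).
    by near=> s; rewrite /flat ifT//; near: s; exact: lt_nbhsr.
  have dV : has_deriv (fun s : R => s^-1) t 1 (- t^-1 ^+ 2).
    apply: has_deriv_eq (has_derivV (lt0r_neq0 t0) (has_deriv_id t 1)) _.
    by rewrite expr2 -mulrA mulN1r.
  have dE : has_deriv (fun s : R => expR (- s^-1)) t 1 (t^-1 ^+ 2 * expR (- t^-1)).
    have dN := has_derivN dV; rewrite opprK in dN.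
    apply: has_deriv_comp dN _.
    have de : differentiable (@expR R) (- t^-1) by apply/derivable1_diffP/derivable_expR.
    split=> //; rewrite deriveE //.
    have -> : 'd expR (- t^-1) (t^-1 ^+ 2) = t^-1 ^+ 2 * 'd expR (- t^-1) 1.
      by rewrite -[X in 'd _ _ X = _]mulr1; exact: linearZ.
    by rewrite -deriveE // derive_val.
  have dX : has_deriv (fun s : R => s^-1 ^+ k) t 1 (- k%:R * t^-1 ^+ k.+1).
    elim: (k) => [|m IH].
      rewrite oppr0 mul0r; apply: has_deriv_near (has_deriv_cst (1 : R) t 1).
      by near=> s; rewrite expr0.
    apply: (@has_deriv_near _ _ _ (fun s : R => s^-1 * s^-1 ^+ m)).
      by near=> s; rewrite exprS.
    apply: has_deriv_eq (has_derivM dV IH) _.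
    by rewrite !exprS expr0 -natr1; ring.
  apply: has_deriv_eq (has_derivM dX dE) _.
  by rewrite /flat t0 !exprS expr0; ring.
rewrite t0 !flat_le0// mulr0 subr0.
suff H : (fun h => h^-1 *: ((flat k \o shift 0) (h *: 1) - flat k 0)) @ 0^' --> (0 : R).
  split; last exact: cvg_lim H.
  by apply/derivable1_diffP; apply/cvg_ex; exists 0.
apply/cvgr0Pnorm_le => e e0.
pose C : R := (k.+2)`!%:R.
have C0 : 0 < C by rewrite ltr0n fact_gt0.
near=> h.
have h0 : h != 0 by near: h; exact: nbhs_dnbhs_neq.
rewrite /= [_%:A]mulr1 addr0 [flat k 0]flat_le0// subr0 normrM normfV.
rewrite ler_pdivrMl ?normr_gt0//.
have /andP[f0 fC] := flat_le_sqr k h; rewrite ger0_norm//.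
apply: le_trans fC _; rewrite -/C -real_normK ?num_real// expr2 mulrCA.
rewrite ler_pM2l ?normr_gt0// -ler_pdivlMl// mulrC.
by near: h; apply: dnbhs0_le; rewrite divr_gt0.
Unshelve. all: by end_near. Qed.

(** The derivatives of flat k along v are combinations of the functions of the
    same family, so they are all continuously differentiable. *)
Lemma smooth_flat k : smooth_on setT (flat k).
Proof.
apply/smooth_onP => m; elim: m k => [|m IH] k.
  by split=> // t _; exact: (flat_deriv k t).1.
apply: (@Ck_step _ _ _ openT _ _ _
  (fun v t => (flat k.+2 t - k%:R * flat k.+1 t) * v)) => [v t _|v].
  have [dt tE] := flat_deriv k t; split=> //.
  rewrite -tE !deriveE // mulrC -[v in LHS]mulr1; exact: linearZ.
apply: (CkM openT); last exact: (Ck_cst openT m v).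
have := CkD openT (IH k.+2) (CkM openT (Ck_cst openT m (- k%:R : R)) (IH k.+1)).
apply: (Ck_ext openT) => t _.
by rewrite mulNr.
Qed.

End FlatFunction.

Section Bump.
Context {R : realType} {n : nat}.

(** The flat function exp(-1/t), evaluated at r^2 minus the squared Euclidean
    distance to x0 and normalised at x0. *)
Lemma exists_bump (x0 : 'rV[R]_n) (W : set 'rV[R]_n) : open W -> W x0 ->
  exists (rho : 'rV[R]_n -> R) (K : set 'rV[R]_n),
    [/\ smooth_on setT rho, rho x0 = 1, compact K, K `<=` W &
        forall x, ~ K x -> rho x = 0].
Proof.
move=> oW Wx0.
have [e /= e0 eW] := (nbhs_ballP _ _).1 (open_nbhs_nbhs (conj oW Wx0)).
pose r := e / 2; have r0 : 0 < r by rewrite divr_gt0.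
pose d (x : 'rV[R]_n) : R := r ^+ 2 - \sum_i (x 0 i - x0 0 i) * (x 0 i - x0 0 i).
have c0 : flat 0 (r ^+ 2) != 0.
  by rewrite /flat exprn_gt0// expr0 mul1r gt_eqF// expR_gt0.
pose rho x := flat 0 (d x) / flat 0 (r ^+ 2).
exists rho, (closed_ball_ Num.norm x0 r); split.
- have sd : smooth_on setT d.
    apply: (smooth_onB openT); first exact: (smooth_on_cst openT (r ^+ 2)).
    apply: (smooth_on_sum openT) => i.
    have si : smooth_on setT (fun x : 'rV[R]_n => x 0 i - x0 0 i).
      apply: (smooth_onB openT); last exact: (smooth_on_cst openT (x0 0 i)).
      exact: (smooth_on_coord openT 0 i (smooth_on_id openT)).
    exact: (smooth_onM openT si si).
  apply: (smooth_onM openT); last exact: (smooth_on_cst openT ((flat 0 (r ^+ 2))^-1)).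
  have cR : coordinates (fun _ : unit => 1 : R) (fun _ x => x).
    split=> [_ y w|y]; first exact: has_deriv_id.
    by rewrite big_const card_unit /= addr0 /GRing.scale /= mulr1.
  exact: (smooth_on_comp openT cR (W := setT)) (smooth_flat 0) sd.
- rewrite /rho /d big1 ?subr0 ?divff// => i _.
  by rewrite subrr mulr0.
- apply: bounded_closed_compact; last exact: closed_closed_ball_.
  exists (`|x0| + r); split; first exact: num_real.
  move=> M hM x; rewrite /closed_ball_ /= => xr; apply: le_trans (ltW hM).
  by rewrite -[x](subrK x0) addrC (le_trans (ler_normD _ _))// lerD2l distrC.
- move=> x; rewrite /closed_ball_ /= => xr; apply: eW.
  rewrite -ball_normE /=; apply: le_lt_trans xr _.
  by rewrite /r ltr_pdivrMr// ltr_pMr// ltr1n.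
(* the Euclidean ball of radius r lies in the ball of the maximum norm *)
- move=> x; apply: contra_notP => /eqP; rewrite /rho mulf_eq0 invr_eq0 (negPf c0) orbF.
  rewrite /flat; case: ifP; last by rewrite eqxx.
  rewrite /d subr_gt0 => sx _; rewrite /closed_ball_ /= /Num.Def.normr /= mx_normrE.
  apply: bigmax_le; first exact: ltW.
  move=> [i j] _ /=; rewrite !mxE !ord1 distrC.
  rewrite -ler_sqr ?nnegrE ?(ltW r0)// real_normK ?num_real// ltW//.
  apply: le_lt_trans sx; rewrite expr2 (bigD1 j)//= lerDl.
  by apply: sumr_ge0 => l _; rewrite -expr2 sqr_ge0.
Qed.

End Bump.

(** * Charts, transitions and tangent vectors *)

Section AtlasGeometry.
Context {R : realType} {E : normedModType R} {P : Type} (A : atlas E P).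

Definition overlap (a b : chart A) : set E :=
  chart_coord a @` (chart_dom a `&` chart_dom b).

Definition transition (a b : chart A) : E -> E := local_rep a (chart_coord b).

(** The part of the axioms of a smooth manifold which only mentions coordinates.
    It makes sense, and is inherited, for the tangent bundle, whose points carry
    no topology here. *)
Definition smooth_atlas : Prop :=
  (forall a : chart A, set_inj (chart_dom a) (chart_coord a)) /\
  (forall a b : chart A,
     open (overlap a b) /\ smooth_on (overlap a b) (transition a b)).

Hypothesis hA : smooth_atlas.
Implicit Types (a b c : chart A) (p q : P).

Lemma overlap_refl a : overlap a a = chart_image a.
Proof. by rewrite /overlap setIid. Qed.

Lemma local_repE (F : normedModType R) a (f : P -> F) p :
  chart_dom a p -> local_rep a f (chart_coord a p) = f p.
Proof.
move=> ap; rewrite /local_rep; case: xgetP => [y _ [q [aq qp] <-]|H].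
  by congr f; apply: (hA.1 a) => //; exact/mem_set.
by exfalso; apply: (H (f p)); exists p.
Qed.

Lemma mem_overlap a b p :
  chart_dom a p -> chart_dom b p -> overlap a b (chart_coord a p).
Proof. by move=> ap bp; exists p. Qed.

Lemma near_overlap a b p : chart_dom a p -> chart_dom b p ->
  \forall z \near chart_coord a p, overlap a b z.
Proof.
move=> ap bp; apply: open_nbhs_nbhs; split; first by have [] := hA.2 a b.
exact: mem_overlap.
Qed.

Lemma transitionE a b p :
  chart_dom a p -> transition a b (chart_coord a p) = chart_coord b p.
Proof. exact: local_repE. Qed.

Lemma local_rep_change (F : normedModType R) a b (f : P -> F) z :
  overlap a b z -> local_rep b f (transition a b z) = local_rep a f z.
Proof. by move=> [p [ap bp] <-]; rewrite transitionE// !local_repE. Qed.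

Lemma overlap_transition a b z : overlap a b z -> overlap b a (transition a b z).
Proof. by move=> [p [ap bp] <-]; rewrite transitionE//; exists p. Qed.

Lemma transition_differentiable a b z :
  overlap a b z -> differentiable (transition a b) z.
Proof. exact: (smooth_on_differentiable (hA.2 a b).2). Qed.

Lemma diff_transition_refl a p z :
  chart_dom a p -> 'd (transition a a) (chart_coord a p) z = z.
Proof.
move=> ap; have H : has_deriv (transition a a) (chart_coord a p) z z.
  apply: has_deriv_near (has_deriv_id _ _).
  apply: filterS (near_overlap ap ap) => x [q [aq _] <-].
  by rewrite transitionE.
exact: (has_deriv_diffE H).
Qed.

(** The cocycle condition, by the chain rule. *)
Lemma diff_transition_comp a b c p z :
  chart_dom a p -> chart_dom b p -> chart_dom c p ->
  'd (transition b c) (chart_coord b p) ('d (transition a b) (chart_coord a p) z) =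
  'd (transition a c) (chart_coord a p) z.
Proof.
move=> ap bp cp.
have dab := transition_differentiable (mem_overlap ap bp).
have dbc := transition_differentiable (mem_overlap bp cp).
have H : has_deriv (transition a c) (chart_coord a p) z
    ('d (transition b c) (chart_coord b p) ('d (transition a b) (chart_coord a p) z)).
  apply: (@has_deriv_near _ _ _ (fun x => transition b c (transition a b x))).
    by apply: filterS (near_overlap ap bp) => x; exact: local_rep_change.
  apply: has_deriv_comp (has_deriv_diff z dab) _.
  by rewrite transitionE//; exact: has_deriv_diff.
exact: (esym (has_deriv_diffE H)).
Qed.

Lemma tangent_of_chart_in a b p z : chart_dom b p ->
  tangent_of_chart a p z b = 'd (transition a b) (chart_coord a p) z.
Proof. by move=> bp; rewrite /tangent_of_chart asboolT. Qed.

Lemma tangent_of_chart_self a p z :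
  chart_dom a p -> tangent_of_chart a p z a = z.
Proof. by move=> ap; rewrite tangent_of_chart_in// diff_transition_refl. Qed.

Lemma tangent_of_chart_out a b p z :
  ~ chart_dom b p -> tangent_of_chart a p z b = 0.
Proof. by move=> bp; rewrite /tangent_of_chart asboolF. Qed.

Lemma tangent_of_chartP a p z :
  chart_dom a p -> tangent_space A p (tangent_of_chart a p z).
Proof.
move=> ap; split=> [b|b c bp cp]; first exact: tangent_of_chart_out.
by rewrite !tangent_of_chart_in// diff_transition_comp.
Qed.

Lemma tangent_spaceE a p v : chart_dom a p -> tangent_space A p v ->
  v = tangent_of_chart a p (v a).
Proof.
move=> ap [v0 vE]; apply/funext => b; have [bp|bp] := pselect (chart_dom b p).
  by rewrite tangent_of_chart_in//; exact: vE.
by rewrite tangent_of_chart_out// v0.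
Qed.

Lemma tangent_space_eq a p v w : chart_dom a p ->
  tangent_space A p v -> tangent_space A p w -> v a = w a -> v = w.
Proof.
by move=> ap tv tw vw; rewrite (tangent_spaceE ap tv) (tangent_spaceE ap tw) vw.
Qed.

Lemma tangent_spaceD p v w :
  tangent_space A p v -> tangent_space A p w -> tangent_space A p (v + w).
Proof.
move=> [v0 vE] [w0 wE]; split=> [b bp|b c bp cp]; rewrite /GRing.add /=.
  by rewrite v0// w0// addr0.
by rewrite (vE b c)// (wE b c)// linearD.
Qed.

Lemma tangent_spaceN p v : tangent_space A p v -> tangent_space A p (- v).
Proof.
move=> [v0 vE]; split=> [b bp|b c bp cp]; rewrite /GRing.opp /=.
  by rewrite v0// oppr0.
by rewrite (vE b c)// linearN.
Qed.

Lemma tangent_spaceB p v w :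
  tangent_space A p v -> tangent_space A p w -> tangent_space A p (v - w).
Proof. by move=> tv /tangent_spaceN; exact: tangent_spaceD. Qed.

Lemma tangent_spaceZ p k v : tangent_space A p v ->
  tangent_space A p (fun b => k *: v b).
Proof.
move=> [v0 vE]; split=> [b bp|b c bp cp]; first by rewrite v0// scaler0.
by rewrite (vE b c)// linearZ.
Qed.

End AtlasGeometry.

Section TangentBundleAtlas.
Context {R : realType} {n : nat} {P : Type} {A : atlas 'rV[R]_n P}.
Hypothesis hA : smooth_atlas A.
Local Notation TM := (tangent_bundle A).
Local Notation TA := (tangent_atlas A).
Local Notation V := ('rV[R]_n * 'rV[R]_n)%type.

Lemma open_fst (W : set 'rV[R]_n) : open W -> open ((fst : V -> 'rV[R]_n) @^-1` W).
Proof. by apply: open_comp => z _; exact: cvg_fst. Qed.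

Definition point_of_chart (a : chart A) (p : P) (ap : chart_dom a p) (y : 'rV[R]_n) : TM :=
  TangentBundle (tangent_of_chartP hA y ap).

(** Every pair (x, y) with x in the base overlap is realised by the tangent
    vector with components y. *)
Lemma tangent_bundle_overlap (a b : chart TA) :
  overlap a b = (fst : V -> _) @^-1` (overlap (A := A) a b).
Proof.
apply/seteqP; split=> [_ [u [au bu] <-]|[x y] [p [ap bp] /= <-]].
  by exists (tb_proj u).
exists (point_of_chart ap y) => //=.
by rewrite tangent_of_chart_self.
Qed.

Lemma tangent_bundle_inj (a : chart TA) : set_inj (chart_dom a) (chart_coord a).
Proof.
move=> [p v tv] [q w tw] /set_mem /= ap /set_mem /= aq [pq vw].
have epq : p = q by apply: (hA.1 a) => //; exact/mem_set.
case: _ / epq in tw aq pq *.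
have evw := tangent_space_eq ap tv tw vw; case: _ / evw in tw vw *.
by rewrite (Prop_irrelevance tv tw).
Qed.

End TangentBundleAtlas.

(** * The atlas of the tangent bundle *)

Section RowValued.
Context {R : realType}.

Lemma smooth_on_rowP (E : normedModType R) (U : set E) n (f : E -> 'rV[R]_n) :
  open U -> (forall j, smooth_on U (fun x => f x 0 j)) -> smooth_on U f.
Proof.
move=> oU sf; apply: (smooth_on_ext oU) (smooth_on_row oU sf) => x _.
by apply/rowP => j; rewrite mxE.
Qed.

Lemma smooth_on_comp_row (E : normedModType R) (U : set E) (F : normedModType R)
    (W : set F) (I : finType) (e : I -> F) (c : I -> F -> R) n
    (f : F -> 'rV[R]_n) (g : E -> F) :
  open U -> open W -> coordinates e c -> (forall z, U z -> W (g z)) ->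
  smooth_on W f -> smooth_on U g -> smooth_on U (fun x => f (g x)).
Proof.
move=> oU oW ec UW sf sg; apply: smooth_on_rowP => // j.
exact: (smooth_on_comp oU ec UW (smooth_on_coord oW 0 j sf) sg).
Qed.

Lemma has_deriv_rowP (E : normedModType R) n (f : E -> 'rV[R]_n) z v (d : 'rV[R]_n) :
  (forall j, has_deriv (fun x => f x 0 j) z v (d 0 j)) -> has_deriv f z v d.
Proof.
move=> fd; rewrite (row_sum_delta d).
have H := has_deriv_sum (index_enum 'I_n)
  (fun j => has_derivZl (delta_mx 0 j : 'rV[R]_n) (fd j)).
by apply: has_deriv_near H; apply: nearW => x; rewrite -row_sum_delta.
Qed.

Lemma has_deriv_row_coord (E : normedModType R) n (f : E -> 'rV[R]_n) z v (d : 'rV[R]_n) j :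
  has_deriv f z v d -> has_deriv (fun x => f x 0 j) z v (d 0 j).
Proof. by move=> fd; exact: (has_deriv_comp fd (has_deriv_coord _ _ _ _)). Qed.

Lemma derive_row_sum n (F : normedModType R) (f : 'rV[R]_n -> F) x y :
  differentiable f x -> 'D_y f x = \sum_i y 0 i *: 'D_(delta_mx 0 i) f x.
Proof.
move=> df; rewrite deriveE// {1}(row_sum_delta y) linear_sum.
by apply: eq_bigr => i _; rewrite linearZ /= deriveE.
Qed.

Lemma derive2_row_sum n (F : normedModType R) (U : set 'rV[R]_n) (f : 'rV[R]_n -> F) x y v :
  open U -> U x -> smooth_on U f ->
  has_deriv (fun x => 'D_y f x) x v
    (\sum_i y 0 i *: 'D_v (fun x => 'D_(delta_mx 0 i) f x) x).
Proof.
move=> oU Ux sf.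
apply: (@has_deriv_near _ _ _ (fun x => \sum_i y 0 i *: 'D_(delta_mx 0 i) f x)).
  apply: filterS (open_nbhs_nbhs (conj oU Ux)) => q Uq.
  by rewrite (derive_row_sum y (smooth_on_differentiable sf Uq)).
apply: has_deriv_sum => i; apply: has_derivZr; apply: has_deriv_self.
exact: (smooth_on_differentiable (smooth_on_derive _ sf) Ux).
Qed.

Lemma derive_coord_sum n m (f : 'rV[R]_n -> 'rV[R]_m) x w k : differentiable f x ->
  ('D_w f x) 0 k = \sum_i w 0 i * ('D_(delta_mx 0 i) f x) 0 k.
Proof.
move=> df; rewrite (derive_row_sum w df) summxE.
by apply: eq_bigr => i _; rewrite mxE.
Qed.

Lemma derive2_coord_sum n m (U : set 'rV[R]_n) (f : 'rV[R]_n -> 'rV[R]_m) x v w k :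
  open U -> U x -> smooth_on U f ->
  ('D_w (fun x => 'D_v f x) x) 0 k = \sum_i \sum_j v 0 i * w 0 j *
    ('D_(delta_mx 0 j) (fun x => 'D_(delta_mx 0 i) f x) x) 0 k.
Proof.
move=> oU Ux sf.
apply: (etrans (congr1 (fun r : 'rV[R]_m => r 0 k) (derive2_row_sum v w oU Ux sf).2)).
rewrite summxE; apply: eq_bigr => i _; rewrite mxE.
have dd := smooth_on_differentiable (smooth_on_derive (delta_mx 0 i) sf) Ux.
apply: (etrans (congr1 (fun r : R => v 0 i * r) (derive_coord_sum w k dd))).
by rewrite mulr_sumr; apply: eq_bigr => j _; rewrite mulrA.
Qed.

(** The tangent map is linear in the second variable, so its derivative along
    (v1, v2) is that of x |-> D_y f x along v1, plus D_(v2) f. *)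
Lemma tangent_map_deriv n m (U : set 'rV[R]_n) (f : 'rV[R]_n -> 'rV[R]_m)
    (z v : 'rV[R]_n * 'rV[R]_n) :
  open U -> U z.1 -> smooth_on U f ->
  has_deriv (fun z : 'rV[R]_n * 'rV[R]_n => (f z.1, 'd f (z.1) z.2)) z v
    ('D_(v.1) f z.1,
     'D_(v.1) (fun x => 'D_(z.2) f x) z.1 + 'D_(v.2) f z.1).
Proof.
move=> oU Uz sf; have df := smooth_on_differentiable sf Uz.
have oUf : open ((fst : 'rV[R]_n * 'rV[R]_n -> 'rV[R]_n) @^-1` U).
  by apply: open_comp => // w _; exact: cvg_fst.
apply: has_deriv_pair.
  exact: (has_deriv_comp (has_deriv_fst z v) (has_deriv_self _ df)).
apply: (@has_deriv_near _ _ _ (fun z : 'rV[R]_n * 'rV[R]_n => \sum_i z.2 0 i *: 'D_(delta_mx 0 i) f z.1)).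
  apply: filterS (open_nbhs_nbhs (conj oUf Uz)) => q Uq.
  have dq := smooth_on_differentiable sf Uq.
  by rewrite -(derive_row_sum _ dq) deriveE.
apply: has_deriv_rowP => j.
apply: (@has_deriv_near _ _ _ (fun z : 'rV[R]_n * 'rV[R]_n =>
    \sum_i z.2 0 i * ('D_(delta_mx 0 i) f z.1) 0 j)).
  by near=> q; rewrite summxE; apply: eq_bigr => i _; rewrite mxE.
have [_ ->] := derive2_row_sum z.2 v.1 oU Uz sf.
rewrite (derive_row_sum v.2 df).
apply: has_deriv_eq.
  apply: has_deriv_sum => i.
  have dD := smooth_on_differentiable (smooth_on_derive (delta_mx 0 i) sf) Uz.
  exact: (has_derivM (has_deriv_row_coord i (has_deriv_snd z v))
    (has_deriv_row_coord j (has_deriv_comp (has_deriv_fst z v) (has_deriv_self v.1 dD)))).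
rewrite big_split /= addrC mxE !summxE; congr (_ + _).
  by apply: eq_bigr => i _; rewrite mxE.
by apply: eq_bigr => i _; rewrite mxE.
Unshelve. all: by end_near. Qed.

Lemma smooth_on_tangent_map n m (U : set 'rV[R]_n) (f : 'rV[R]_n -> 'rV[R]_m) :
  open U -> smooth_on U f ->
  smooth_on ((fst : 'rV[R]_n * 'rV[R]_n -> 'rV[R]_n) @^-1` U)
    (fun z => (f z.1, 'd f (z.1) z.2)).
Proof.
move=> oU sf.
have oUf : open ((fst : 'rV[R]_n * 'rV[R]_n -> 'rV[R]_n) @^-1` U).
  by apply: open_comp => // w _; exact: cvg_fst.
have sfst : smooth_on ((fst : 'rV[R]_n * 'rV[R]_n -> 'rV[R]_n) @^-1` U) fst.
  exact: (smooth_on_linr oUf (@has_deriv_fst _ _ _) (smooth_on_id oUf)).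
have ssnd : smooth_on ((fst : 'rV[R]_n * 'rV[R]_n -> 'rV[R]_n) @^-1` U) snd.
  exact: (smooth_on_linr oUf (@has_deriv_snd _ _ _) (smooth_on_id oUf)).
have ec := @coordinates_row R n.
apply: (smooth_on_pair oUf); first exact: (smooth_on_comp_row oUf oU ec _ sf sfst).
apply: (smooth_on_rowP oUf) => j.
have H : smooth_on ((fst : 'rV[R]_n * 'rV[R]_n -> 'rV[R]_n) @^-1` U)
    (fun z => \sum_i z.2 0 i * ('D_(delta_mx 0 i) f z.1) 0 j).
  apply: (smooth_on_sum oUf) => i; apply: (smooth_onM oUf).
    exact: (smooth_on_coord oUf 0 i ssnd).
  apply: (smooth_on_coord oUf).
  exact: (smooth_on_comp_row oUf oU ec _ (smooth_on_derive _ sf) sfst).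
apply: (smooth_on_ext oUf) H => q /set_mem Uq.
have dq := smooth_on_differentiable sf Uq.
rewrite -deriveE// (derive_row_sum _ dq) summxE.
by apply: eq_bigr => i _; rewrite mxE.
Qed.

End RowValued.

Section TangentBundleTransitions.
Context {R : realType} {n : nat} {P : Type} {A : atlas 'rV[R]_n P}.
Hypothesis hA : smooth_atlas A.
Local Notation TM := (tangent_bundle A).
Local Notation TA := (tangent_atlas A).
Local Notation V := ('rV[R]_n * 'rV[R]_n)%type.

Lemma tangent_bundle_transition (a b : chart TA) (z : V) :
  overlap a b z ->
  transition a b z = (transition (A := A) a b z.1, 'd (transition (A := A) a b) (z.1) z.2).
Proof.
move=> [u [au bu] <-]; rewrite {1}/transition.
rewrite [LHS]/local_rep; case: xgetP => [y _ [w [aw wu] <-]|H].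
  have := tangent_bundle_inj hA (mem_set aw) (mem_set au) wu => ->.
  rewrite /= (transitionE hA)//; congr (_, _).
  by have [_ H] := tb_vecP u; exact: H.
by exfalso; apply: (H (chart_coord b u)); exists u.
Qed.

Lemma tangent_bundle_smooth_atlas : smooth_atlas TA.
Proof.
split=> [a|a b]; first exact: tangent_bundle_inj.
have [oab sab] := hA.2 a b.
have oT : open (overlap a b : set V).
  by rewrite tangent_bundle_overlap//; exact: open_fst.
split=> //; apply: (smooth_on_ext oT); last first.
  rewrite tangent_bundle_overlap//; exact: smooth_on_tangent_map oab sab.
by move=> z /set_mem /tangent_bundle_transition ->.
Qed.

Let hTA := tangent_bundle_smooth_atlas.

Lemma transition_deriv (a b : chart TA) (u : TM) (v : V) :
  chart_dom a u -> chart_dom b u ->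
  let f := transition (A := A) a b in let z := chart_coord a u in
  'd (transition a b) z v =
  ('D_(v.1) f z.1, 'D_(v.1) (fun x => 'D_(z.2) f x) z.1 + 'D_(v.2) f z.1).
Proof.
move=> au bu f z; have [oab sab] := hA.2 a b.
have Uz : overlap (A := A) a b z.1 by exists (tb_proj u).
have H := tangent_map_deriv v oab Uz sab.
have [] : has_deriv (transition a b) z v
  ('D_(v.1) f z.1, 'D_(v.1) (fun x => 'D_(z.2) f x) z.1 + 'D_(v.2) f z.1).
  apply: has_deriv_near H.
  apply: filterS (near_overlap hTA au bu) => w oz.
  by rewrite tangent_bundle_transition.
by move=> dt; rewrite deriveE.
Qed.

(** Read in charts of the tangent bundle the projection is (x, y) |-> x followed
    by a transition of the base, so its differential only sees the first
    component. *)
Lemma vertical_spaceP (a : chart TA) (u : TM) w : chart_dom a u ->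
  vertical_space u w <-> tangent_space TA u w /\ (w a).1 = 0.
Proof.
have key (c : chart TA) (b : chart A) : chart_dom c u -> chart_dom b (tb_proj u) ->
  'd (local_rep c (chart_coord b \o @tb_proj _ _ _ A)) (chart_coord c u) (w c) =
  'd (transition (A := A) c b) (chart_coord (c : chart A) (tb_proj u)) (w c).1.
  move=> cu bu.
  have dt := transition_differentiable hA (mem_overlap (cu : chart_dom (c : chart A) _) bu).
  have H : has_deriv (fun z : V => transition (A := A) c b z.1) (chart_coord c u) (w c)
    ('d (transition (A := A) c b) (chart_coord (c : chart A) (tb_proj u)) (w c).1).
    apply: (has_deriv_comp (has_deriv_fst _ _)); exact: has_deriv_diff.
  have [] : has_deriv (local_rep c (chart_coord b \o @tb_proj _ _ _ A)) (chart_coord c u) (w c)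
    ('d (transition (A := A) c b) (chart_coord (c : chart A) (tb_proj u)) (w c).1).
    apply: has_deriv_near H.
    apply: filterS (near_overlap hTA cu cu) => _ [q [cq _] <-].
    rewrite (local_repE hTA)//; exact: (transitionE hA).
  by move=> dl; rewrite deriveE.
move=> au; split=> [[tw vw]|[tw wa]]; split=> //.
  by have := vw a a au au; rewrite key// diff_transition_refl.
move=> c b cu bu; rewrite key//.
have -> : (w c).1 = 0; last by rewrite linear0.
rewrite (tw.2 a c au cu) -/(transition a c) transition_deriv//= wa.
by rewrite derive0.
Qed.

End TangentBundleTransitions.

(** * A regular Lagrangian in coordinates *)

Section LinearEquations.
Context {R : realType}.
Implicit Types a b e f s t x y : R.

(** In the next two lemmas a and b are the (k, j) and (j, k) entries of g N, s is
    a derivative of g along the spray, t a derivative along the base, and e, f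
    are the mixed second derivatives of the Lagrangian. *)
Lemma half_difference a b e f s t : 4 * (a + s) = t + e - f ->
  4 * (b + s) = t + f - e -> e - f = 2 * (a - b).
Proof. lra. Qed.

Lemma half_sum a b e f s t : 4 * (a + - 2^-1 * s) = 2 * t + e - f ->
  4 * (b + - 2^-1 * s) = 2 * t + f - e -> t + s = a + b.
Proof. lra. Qed.

Lemma eq_of_parts a b a' b' x y : x = 2 * (a - b) -> y = a + b ->
  x = 2 * (a' - b') -> y = a' + b' -> a = a'.
Proof. lra. Qed.

Lemma solve_for_spray g q s : q + - 2 * s = - 2 * g -> g = s - 2^-1 * q.
Proof. lra. Qed.

End LinearEquations.

Lemma sum_delta_row (R : realType) n (F : 'I_n -> R) k :
  \sum_i (delta_mx 0 k : 'rV[R]_n) 0 i * F i = F k.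
Proof.
rewrite (bigD1 k)//= big1 ?addr0; first by rewrite mxE !eqxx mul1r.
by move=> i ik; rewrite mxE (negbTE ik) andbF mul0r.
Qed.

Lemma ey_snd (R : realType) n (j h : 'I_n) : (ey j : 'rV[R]_n * 'rV[R]_n).2 0 h = (h == j)%:R.
Proof. by rewrite mxE eqxx. Qed.

Section LocalLagrangian.
Context {R : realType} {n : nat}.
Local Notation V := ('rV[R]_n * 'rV[R]_n)%type.

Lemma derive_pair_sum (f : V -> R) (z v : V) : differentiable f z ->
  'D_v f z = \sum_i v.1 0 i * pdx i f z + \sum_i v.2 0 i * pdy i f z.
Proof.
move=> df; have [_ ec] := @coordinates_pair_row R n.
rewrite deriveE// {1}(ec v) linear_sum big_sumType /=.
by congr (_ + _); apply: eq_bigr => i _; rewrite /pdx /pdy deriveE//; exact: linearZ.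
Qed.

Lemma derive_ver_sum (f : V -> R) (z : V) (e : 'rV[R]_n) : differentiable f z ->
  'D_(0, e) f z = \sum_i e 0 i * pdy i f z.
Proof.
move=> df; apply: (etrans (derive_pair_sum (0, e) df)).
rewrite /= [X in X + _]big1; first exact: add0r.
by move=> i _; rewrite mxE mul0r.
Qed.

Lemma derive_hor_sum (f : V -> R) (z : V) (e : 'rV[R]_n) : differentiable f z ->
  'D_(e, 0) f z = \sum_i e 0 i * pdx i f z.
Proof.
move=> df; apply: (etrans (derive_pair_sum (e, 0) df)).
rewrite /= [X in _ + X]big1; first exact: addr0.
by move=> i _; rewrite mxE mul0r.
Qed.

Lemma derive_pair_split (f : V -> R) (z : V) (e w : 'rV[R]_n) : differentiable f z ->
  'D_(e, w) f z = 'D_(e, 0) f z + \sum_i w 0 i * pdy i f z.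
Proof.
move=> df; apply: (etrans (derive_pair_sum (e, w) df)).
exact: (congr1 (fun a : R => a + _) (esym (derive_hor_sum e df))).
Qed.

Variables (U : set V) (l : V -> R).
Hypotheses (oU : open U) (sl : smooth_on U l).
Hypothesis reg : forall z, U z -> metric l z \in unitmx.

Lemma derive_commute_on (f : V -> R) z v w : smooth_on U f -> U z ->
  'D_v (fun x => 'D_w f x) z = 'D_w (fun x => 'D_v f x) z.
Proof.
move=> sf Uz; apply: derive_commute.
- apply: filterS (open_nbhs_nbhs (conj oU Uz)) => x.
  exact: (smooth_on_differentiable sf).
- exact: (smooth_on_differentiable (smooth_on_derive _ sf)).
- exact: (smooth_on_differentiable (smooth_on_derive _ sf)).
Qed.

Lemma pdy_comm (f : V -> R) z i j : smooth_on U f -> U z ->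
  pdy i (pdy j f) z = pdy j (pdy i f) z.
Proof. by move=> sf Uz; exact: (derive_commute_on (ey i) (ey j) sf Uz). Qed.

Lemma pdx_pdy_comm (f : V -> R) z i j : smooth_on U f -> U z ->
  pdx i (pdy j f) z = pdy j (pdx i f) z.
Proof. by move=> sf Uz; exact: (derive_commute_on (ex i) (ey j) sf Uz). Qed.

Lemma smooth_pdy (f : V -> R) i : smooth_on U f -> smooth_on U (pdy i f).
Proof. exact: smooth_on_derive. Qed.

Lemma smooth_pdx (f : V -> R) i : smooth_on U f -> smooth_on U (pdx i f).
Proof. exact: smooth_on_derive. Qed.

Lemma smooth_metric i j : smooth_on U (fun z => metric l z i j).
Proof.
have H := smooth_onMl oU 2^-1 (smooth_pdy i (smooth_pdy j sl)).
by apply: (smooth_on_ext oU) H => z _; rewrite mxE.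
Qed.

Lemma smooth_snd_coord i : smooth_on U (fun z : V => z.2 0 i).
Proof.
by apply: (smooth_on_coord oU); exact: (smooth_on_linr oU (@has_deriv_snd _ _ _) (smooth_on_id oU)).
Qed.

Lemma smooth_spray_coef i : smooth_on U (spray_coef l i).
Proof.
apply: (smooth_onMl oU); apply: (smooth_on_sum oU) => k; apply: (smooth_onM oU).
  exact: (smooth_on_invmx oU reg smooth_metric).
apply: (smooth_onB oU); last exact: (smooth_pdx _ sl).
apply: (smooth_on_sum oU) => h; apply: (smooth_onM oU); last exact: smooth_snd_coord.
exact: (smooth_pdy _ (smooth_pdx _ sl)).
Qed.

Lemma metric_sym z i j : U z -> metric l z i j = metric l z j i.
Proof. by move=> Uz; rewrite !mxE (pdy_comm i j sl Uz). Qed.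

(** The definition of the spray with g moved to the other side: in this form it
    can be differentiated without touching the inverse of g. *)
Lemma spray_coefE z k : U z ->
  4 * \sum_m metric l z k m * spray_coef l m z =
  \sum_h pdy k (pdx h l) z * z.2 0 h - pdx k l z.
Proof.
move=> Uz; pose b : 'cV[R]_n := \col_k (\sum_h pdy k (pdx h l) z * z.2 0 h - pdx k l z).
have -> : \sum_h pdy k (pdx h l) z * z.2 0 h - pdx k l z = b k 0 by rewrite mxE.
rewrite -[b](mulKVmx (reg Uz)) mxE mulr_sumr; apply: eq_bigr => m _.
rewrite /spray_coef mulrCA; congr (_ * _); rewrite mulrA mulfV ?mul1r ?pnatr_eq0//.
by rewrite mxE; apply: eq_bigr => i _; rewrite mxE.
Qed.

(** Differentiation of spray_coefE along the fibre. *)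
Lemma metric_canonic z k j : U z ->
  4 * (\sum_m (pdy j (fun x => metric l x k m) z * spray_coef l m z
            + metric l z k m * pdy j (spray_coef l m) z)) =
  \sum_h pdy j (pdy k (pdx h l)) z * z.2 0 h + pdy k (pdx j l) z - pdy j (pdx k l) z.
Proof.
move=> Uz.
have D f : smooth_on U f -> has_deriv f z (ey j) (pdy j f z).
  by move=> sf; apply: has_deriv_self; exact: (smooth_on_differentiable sf Uz).
have H1 : has_deriv (fun z => 4 * \sum_m metric l z k m * spray_coef l m z) z (ey j)
  (4 * (\sum_m (pdy j (fun x => metric l x k m) z * spray_coef l m z
            + metric l z k m * pdy j (spray_coef l m) z))).
  apply: has_derivMl; apply: has_deriv_sum => m.
  exact: (has_derivM (D _ (smooth_metric k m)) (D _ (smooth_spray_coef m))).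
have s2 h : smooth_on U (pdy k (pdx h l)).
  exact: (smooth_pdy _ (smooth_pdx _ sl)).
have H2 : has_deriv (fun z : V => \sum_h pdy k (pdx h l) z * z.2 0 h - pdx k l z) z (ey j)
  (\sum_h (pdy j (pdy k (pdx h l)) z * z.2 0 h + pdy k (pdx h l) z * (ey j : V).2 0 h)
    - pdy j (pdx k l) z).
  apply: has_derivB; last exact: (D _ (smooth_pdx _ sl)).
  apply: has_deriv_sum => h; apply: (has_derivM (D _ (s2 h))).
  exact: (has_deriv_row_coord h (has_deriv_snd z (ey j))).
have [_ <-] := H1.
have [_ ->] := has_deriv_near (near_open oU Uz (fun x Ux => esym (spray_coefE k Ux))) H2.
congr (_ - _); rewrite big_split /=; congr (_ + _).
rewrite (bigD1 j)//= big1 ?addr0 ?ey_snd ?eqxx ?mulr1// => h hj.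
by rewrite ey_snd (negbTE hj) mulr0.
Qed.

Definition canonic_matrix z : 'M[R]_n := \matrix_(i, j) pdy j (spray_coef l i) z.

Lemma metric_canonicE z k j : U z ->
  4 * ((metric l z *m canonic_matrix z) k j
       + \sum_m pdy j (fun x => metric l x k m) z * spray_coef l m z) =
  \sum_h pdy j (pdy k (pdx h l)) z * z.2 0 h + pdy k (pdx j l) z - pdy j (pdx k l) z.
Proof.
move=> Uz; rewrite -metric_canonic// addrC mxE -big_split; congr (_ * _).
by apply: eq_bigr => m _; rewrite [canonic_matrix z m j]mxE.
Qed.

Lemma pdy_metric z i j m : U z ->
  pdy m (fun x => metric l x i j) z = 2^-1 * pdy m (pdy i (pdy j l)) z.
Proof.
move=> Uz.
have s2 : smooth_on U (pdy i (pdy j l)).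
  exact: (smooth_pdy _ (smooth_pdy _ sl)).
have -> : (fun x => metric l x i j) = (fun x => 2^-1 * pdy i (pdy j l) x).
  by apply/funext => x; rewrite mxE.
exact: (has_derivMl 2^-1 (has_deriv_self (ey m) (smooth_on_differentiable s2 Uz))).2.
Qed.

(** With pdy_metricC: the fibre derivative of g, a third derivative of the
    Lagrangian, is totally symmetric. *)
Lemma pdy_metric_sym z i j m : U z ->
  pdy m (fun x => metric l x i j) z = pdy i (fun x => metric l x m j) z.
Proof.
move=> Uz; rewrite (pdy_metric i j m Uz) (pdy_metric m j i Uz).
by rewrite (pdy_comm m i (smooth_pdy j sl) Uz).
Qed.

Lemma pdy_metricC z i j m : U z ->
  pdy m (fun x => metric l x i j) z = pdy m (fun x => metric l x j i) z.
Proof.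
by move=> Uz; apply: near_eq_derive; apply: (near_open oU Uz) => x Ux; exact: metric_sym.
Qed.

(** The condition that the n-plane with connection coefficients N at z is
    isotropic for the Cartan form; see cartan_two_form_graph. *)
Definition lagrangian_eq z (N : 'M[R]_n) : Prop := forall k j,
  pdy k (pdx j l) z - pdy j (pdx k l) z =
  2 * ((metric l z *m N) k j - (metric l z *m N) j k).

(** The equation nabla g = 0 at z, for the connection coefficients N; see
    nabla_metric_local. *)
Definition parallel_eq z (N : 'M[R]_n) : Prop := forall k j,
  'D_(z.2, - 2 *: \row_i spray_coef l i z) (fun x => metric l x k j) z =
  (metric l z *m N) k j + (metric l z *m N) j k.

(** Antisymmetrise metric_canonicE: the derivatives of g along the spray and the
    third derivatives of the Lagrangian are symmetric and cancel. *)
Lemma canonic_lagrangian_eq z : U z -> lagrangian_eq z (canonic_matrix z).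
Proof.
move=> Uz k j; have Ekj := metric_canonicE k j Uz; have Ejk := metric_canonicE j k Uz.
have e1 : \sum_m pdy j (fun x => metric l x k m) z * spray_coef l m z =
          \sum_m pdy k (fun x => metric l x j m) z * spray_coef l m z.
  by apply: eq_bigr => m _; rewrite (pdy_metric_sym k m j Uz).
have e2 : \sum_h pdy j (pdy k (pdx h l)) z * z.2 0 h =
          \sum_h pdy k (pdy j (pdx h l)) z * z.2 0 h.
  by apply: eq_bigr => h _; rewrite (pdy_comm j k (smooth_pdx h sl) Uz).
rewrite e1 e2 in Ekj.
exact: (half_difference Ekj Ejk).
Qed.

(** Symmetrise metric_canonicE: the mixed second derivatives cancel, and what
    remains is the derivative of g along the semispray. *)
Lemma canonic_parallel_eq z : U z -> parallel_eq z (canonic_matrix z).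
Proof.
move=> Uz k j; have Ekj := metric_canonicE k j Uz; have Ejk := metric_canonicE j k Uz.
rewrite (derive_pair_sum _ (smooth_on_differentiable (smooth_metric k j) Uz)) /=.
have half2 (a b : R) : a * b = - 2^-1 * (- 2 * b * a) by field.
have e1 : \sum_m pdy j (fun x => metric l x k m) z * spray_coef l m z =
   - 2^-1 * \sum_m (- 2 *: \row_i spray_coef l i z) 0 m * pdy m (fun x => metric l x k j) z.
  rewrite mulr_sumr; apply: eq_bigr => m _; rewrite !mxE.
  rewrite (pdy_metricC k m j Uz) (pdy_metric_sym m k j Uz) (pdy_metricC j k m Uz).
  exact: half2.
have e1' : \sum_m pdy k (fun x => metric l x j m) z * spray_coef l m z =
   - 2^-1 * \sum_m (- 2 *: \row_i spray_coef l i z) 0 m * pdy m (fun x => metric l x k j) z.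
  rewrite mulr_sumr; apply: eq_bigr => m _; rewrite !mxE.
  rewrite (pdy_metricC j m k Uz) (pdy_metric_sym m j k Uz).
  exact: half2.
have T h : pdx h (fun x => metric l x k j) z = 2^-1 * pdy k (pdy j (pdx h l)) z.
  have s2 : smooth_on U (pdy k (pdy j l)).
    exact: (smooth_pdy _ (smooth_pdy _ sl)).
  have -> : pdx h (fun x => metric l x k j) z = 2^-1 * pdx h (pdy k (pdy j l)) z.
    have -> : (fun x => metric l x k j) = (fun x => 2^-1 * pdy k (pdy j l) x).
      by apply/funext => x; rewrite mxE.
    exact: (has_derivMl 2^-1 (has_deriv_self (ex h) (smooth_on_differentiable s2 Uz))).2.
  rewrite (pdx_pdy_comm h k (smooth_pdy j sl) Uz).
  have H : pdy k (pdx h (pdy j l)) z = pdy k (pdy j (pdx h l)) z.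
    apply: near_eq_derive; apply: (near_open oU Uz) => x Ux.
    exact: (pdx_pdy_comm h j sl Ux).
  exact: (congr1 (fun t => 2^-1 * t) H).
have e2 : \sum_h pdy k (pdy j (pdx h l)) z * z.2 0 h =
          2 * \sum_i z.2 0 i * pdx i (fun x => metric l x k j) z.
  have half2' (a b : R) : a * b = 2 * (b * (2^-1 * a)) by field.
  by rewrite mulr_sumr; apply: eq_bigr => h _; rewrite (T h); exact: half2'.
have e3 : \sum_h pdy j (pdy k (pdx h l)) z * z.2 0 h =
          2 * \sum_i z.2 0 i * pdx i (fun x => metric l x k j) z.
  by rewrite -e2; apply: eq_bigr => h _; rewrite (pdy_comm j k (smooth_pdx h sl) Uz).
rewrite e1 e3 in Ekj; rewrite e1' e2 in Ejk.
exact: (half_sum Ekj Ejk).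
Qed.

(** The first equation gives the antisymmetric part of g N, the second one its
    symmetric part, and g is invertible. *)
Lemma connection_matrix_unique z N N' : U z ->
  lagrangian_eq z N -> parallel_eq z N -> lagrangian_eq z N' -> parallel_eq z N' ->
  N = N'.
Proof.
move=> Uz lN pN lN' pN'; rewrite -[N](mulKmx (reg Uz)) -[N'](mulKmx (reg Uz)).
congr (_ *m _); apply/matrixP => k j.
exact: (eq_of_parts (lN k j) (pN k j) (lN' k j) (pN' k j)).
Qed.

(** The horizontal vectors, in components, of a connection with coefficients N. *)
Definition graph_of (N : 'M[R]_n) : set V :=
  [set v : V | forall i, v.2 0 i = - \sum_j N i j * v.1 0 j].

(** A graph is spanned by the vectors d/dx^j - N^i_j d/dy^i, on which the Cartan
    form takes the values in the last factor, up to the coefficient 1/2. *)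
Lemma cartan_two_form_graph z (N : 'M[R]_n) (v w : V) : U z ->
  graph_of N v -> graph_of N w ->
  cartan_two_form l z v w = 2^-1 * \sum_k \sum_j w.1 0 k * v.1 0 j *
    (pdy k (pdx j l) z - pdy j (pdx k l) z -
     2 * ((metric l z *m N) k j - (metric l z *m N) j k)).
Proof.
move=> Uz gv gw; rewrite /cartan_two_form /ext_deriv; congr (_ * _).
have key v' w' : graph_of N v' ->
    'D_v' ((cartan_one_form l)^~ w') z = \sum_k \sum_j w'.1 0 k * v'.1 0 j *
      (pdy k (pdx j l) z - 2 * (metric l z *m N) k j).
  move=> gv'.
  have sk k := smooth_pdy k sl.
  have [_ ->] : has_deriv ((cartan_one_form l)^~ w') z v' (\sum_k 'D_v' (pdy k l) z * w'.1 0 k).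
    apply: has_deriv_sum => k.
    apply: has_deriv_eq (has_derivM (has_deriv_self v' (smooth_on_differentiable (sk k) Uz))
      (has_deriv_cst (w'.1 0 k) z v')) _.
    by rewrite mulr0 addr0.
  apply: eq_bigr => k _.
  have E1 : \sum_i v'.1 0 i * pdx i (pdy k l) z = \sum_i v'.1 0 i * pdy k (pdx i l) z.
    apply: eq_bigr => i _.
    exact: (congr1 (fun t => v'.1 0 i * t) (pdx_pdy_comm i k sl Uz)).
  have E2 : \sum_i v'.2 0 i * pdy i (pdy k l) z =
            - \sum_j v'.1 0 j * (2 * (metric l z *m N) k j).
    under eq_bigr do rewrite gv' mulNr mulr_suml.
    rewrite sumrN exchange_big /=; congr (- _); apply: eq_bigr => j _.
    rewrite mxE !mulr_sumr; apply: eq_bigr => i _.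
    rewrite (metric_sym k i Uz) [metric l z i k]mxE.
    have swap_half (a b x : R) : a * b * x = b * (2 * (2^-1 * x * a)) by field.
    exact: swap_half.
  have D := derive_pair_sum v' (smooth_on_differentiable (sk k) Uz).
  rewrite (etrans D (congr2 (fun a b : R => a + b) E1 E2)).
  rewrite -sumrB mulr_suml; apply: eq_bigr => j _.
  have factor_out (a b x y : R) : (b * x - b * (2 * y)) * a = a * b * (x - 2 * y) by ring.
  exact: factor_out.
rewrite (key v w gv) (key w v gw) [X in _ - X]exchange_big /= -sumrB.
apply: eq_bigr => k _; rewrite -sumrB; apply: eq_bigr => j _.
have factor_difference (a b x y s t : R) :
  a * b * (x - 2 * s) - b * a * (y - 2 * t) = a * b * (x - y - 2 * (s - t)) by ring.
exact: factor_difference.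
Qed.

(** The derivatives of the components of X and Y cancel by the Leibniz rule:
    nabla g is a tensor. *)
Lemma nabla_metric_local z (N : 'M[R]_n) (X Y : 'I_n -> V -> R) (S : V) : U z ->
  (forall i, differentiable (X i) z) -> (forall i, differentiable (Y i) z) ->
  'D_S (fun x => \sum_i \sum_j metric l x i j * X i x * Y j x) z
  - \sum_i \sum_j metric l z i j * ('D_S (X i) z + \sum_m X m z * N i m) * Y j z
  - \sum_i \sum_j metric l z i j * X i z * ('D_S (Y j) z + \sum_m Y m z * N j m) =
  \sum_i \sum_j X i z * Y j z * ('D_S (fun x => metric l x i j) z
     - ((metric l z *m N) i j + (metric l z *m N) j i)).
Proof.
move=> Uz dX dY.
have [_ ->] : has_deriv (fun x => \sum_i \sum_j metric l x i j * X i x * Y j x) z S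
  (\sum_i \sum_j (('D_S (fun x => metric l x i j) z * X i z + metric l z i j * 'D_S (X i) z) * Y j z
     + metric l z i j * X i z * 'D_S (Y j) z)).
  apply: has_deriv_sum => i; apply: has_deriv_sum => j.
  apply: has_derivM (has_deriv_self S (dY j)).
  apply: has_derivM (has_deriv_self S (dX i)).
  exact: has_deriv_self (smooth_on_differentiable (smooth_metric i j) Uz).
have e1 : \sum_i \sum_j metric l z i j * (\sum_m X m z * N i m) * Y j z =
          \sum_i \sum_j X i z * Y j z * (metric l z *m N) j i.
  rewrite [LHS]exchange_big [RHS]exchange_big; apply: eq_bigr => j _ /=.
  under eq_bigr do rewrite mulr_sumr mulr_suml.
  rewrite exchange_big /=; apply: eq_bigr => m _; rewrite mxE mulr_sumr.
  by apply: eq_bigr => i _; rewrite (metric_sym j i Uz); ring.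
have e2 : \sum_i \sum_j metric l z i j * X i z * (\sum_m Y m z * N j m) =
          \sum_i \sum_j X i z * Y j z * (metric l z *m N) i j.
  apply: eq_bigr => i _; under eq_bigr do rewrite mulr_sumr.
  rewrite exchange_big /=; apply: eq_bigr => m _; rewrite mxE mulr_sumr.
  by apply: eq_bigr => j _; ring.
have -> : \sum_i \sum_j metric l z i j * ('D_S (X i) z + \sum_m X m z * N i m) * Y j z =
  \sum_i \sum_j (metric l z i j * 'D_S (X i) z * Y j z + X i z * Y j z * (metric l z *m N) j i).
  under [RHS]eq_bigr do rewrite big_split.
  rewrite [RHS]big_split -e1 /= -big_split; apply: eq_bigr => i _.
  by rewrite -big_split; apply: eq_bigr => j _ /=; ring.
have -> : \sum_i \sum_j metric l z i j * X i z * ('D_S (Y j) z + \sum_m Y m z * N j m) =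
  \sum_i \sum_j (metric l z i j * X i z * 'D_S (Y j) z + X i z * Y j z * (metric l z *m N) i j).
  under [RHS]eq_bigr do rewrite big_split.
  rewrite [RHS]big_split -e2 /= -big_split; apply: eq_bigr => i _.
  by rewrite -big_split; apply: eq_bigr => j _ /=; ring.
rewrite -!sumrB; apply: eq_bigr => i _; rewrite -!sumrB; apply: eq_bigr => j _.
by ring.
Qed.

End LocalLagrangian.

(** * The semispray under a change of charts *)

Section SprayCovariance.
Context {R : realType} {n : nat}.
Local Notation row := 'rV[R]_n.
Local Notation V := ('rV[R]_n * 'rV[R]_n)%type.

(* phi is a transition of the base and Phi its tangent map; la and lb are one
   Lagrangian read in two charts. *)
Variables (U : set row) (W : set V) (phi : row -> row) (la lb : V -> R).
Let TU : set V := (fst : V -> row) @^-1` U.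
Let Phi (z : V) : V := (phi z.1, 'd phi (z.1) z.2).
Let Ga (z : V) : row := \row_i spray_coef la i z.
Let Gb (z : V) : row := \row_i spray_coef lb i z.
Hypotheses (oU : open U) (oW : open W) (sphi : smooth_on U phi).
Hypotheses (sla : smooth_on TU la) (slb : smooth_on W lb).
Hypothesis PhiW : forall z, TU z -> W (Phi z).
Hypothesis lab : forall z, TU z -> la z = lb (Phi z).
Hypothesis rega : forall z, TU z -> metric la z \in unitmx.
Hypothesis regb : forall z, W z -> metric lb z \in unitmx.
Hypothesis surj : forall x, U x -> forall w, exists e, 'D_e phi x = w.

Let oTU : open TU. Proof. by apply: open_comp => // z _; exact: cvg_fst. Qed.

Let dphi x : U x -> differentiable phi x.
Proof. exact: (smooth_on_differentiable sphi). Qed.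

Let ddphi e x : U x -> differentiable (fun x => 'D_e phi x) x.
Proof. exact: (smooth_on_differentiable (smooth_on_derive e sphi)). Qed.

Let Phi_deriv z v : TU z -> has_deriv Phi z v
  ('D_(v.1) phi z.1, 'D_(v.1) (fun x => 'D_(z.2) phi x) z.1 + 'D_(v.2) phi z.1).
Proof. by move=> Uz; exact: tangent_map_deriv oU Uz sphi. Qed.

(** The Euler-Lagrange covector of l evaluated on e, at the second-order jet with
    position z.1, velocity z.2 and acceleration zeta. *)
Definition euler_lagrange (l : V -> R) (z : V) (zeta e : row) : R :=
  'D_(z.2, zeta) (fun x => 'D_(0, e) l x) z - 'D_(e, 0) l z.

Lemma row_derive_comm x v w : U x ->
  'D_v (fun x => 'D_w phi x) x = 'D_w (fun x => 'D_v phi x) x.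
Proof.
move=> Ux; apply/rowP => k.
have cD u y : U y -> ('D_u phi y) 0 k = 'D_u (fun x => phi x 0 k) y.
  by move=> Uy; have [_ ->] := has_deriv_row_coord k (has_deriv_self u (dphi Uy)).
have sk := smooth_on_coord oU 0 k sphi.
have nU (Q : row -> Prop) : (forall y, U y -> Q y) -> \forall y \near x, Q y.
  by move=> UQ; apply: filterS (open_nbhs_nbhs (conj oU Ux)) => y /UQ.
have D2 u t : ('D_u (fun x => 'D_t phi x) x) 0 k = 'D_u (fun x => 'D_t (fun x => phi x 0 k) x) x.
  have [_ <-] := has_deriv_row_coord k (has_deriv_self u (ddphi t Ux)).
  by apply: near_eq_derive; apply: nU => y; exact: cD.
apply: (etrans (D2 v w)); apply: esym; apply: (etrans (D2 w v)).
have dk := nU _ (fun y => smooth_on_differentiable sk (z := y)).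
exact: (derive_commute dk (smooth_on_differentiable (smooth_on_derive v sk) Ux)
  (smooth_on_differentiable (smooth_on_derive w sk) Ux)).
Qed.

Lemma derive_vertical z e : TU z ->
  'D_(0, e) la z = \sum_i ('D_e phi z.1) 0 i * pdy i lb (Phi z).
Proof.
move=> Uz; have dlb := smooth_on_differentiable slb (PhiW Uz).
have H : has_deriv la z (0, e) ('D_(0, 'D_e phi z.1) lb (Phi z)).
  apply: (@has_deriv_near _ _ _ (fun z => lb (Phi z))).
    by apply: (near_open oTU Uz) => x Ux; rewrite lab.
  apply: (has_deriv_comp _ (has_deriv_self _ dlb)).
  by apply: has_deriv_eq (Phi_deriv (0, e) Uz) _; rewrite /= !derive0 add0r.
exact: (etrans H.2 (derive_ver_sum _ dlb)).
Qed.

(** A change of coordinates adds to both terms of the Euler-Lagrange expression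
    the same sum of second derivatives of phi, so their difference is a covector:
    S below is this sum, and it drops out. *)
Lemma euler_lagrange_covariant z zeta e : TU z ->
  euler_lagrange la z zeta e =
  euler_lagrange lb (Phi z) ('d Phi z (z.2, zeta)).2 ('D_e phi z.1).
Proof.
move=> Uz; have dlb := smooth_on_differentiable slb (PhiW Uz).
have [dP PE] := Phi_deriv (z.2, zeta) Uz.
have dPE : 'd Phi z (z.2, zeta) = ((Phi z).2, ('d Phi z (z.2, zeta)).2).
  by rewrite -deriveE// PE /= deriveE//; exact: dphi.
have sy i : smooth_on W (pdy i lb) by exact: smooth_on_derive slb.
have dy i := smooth_on_differentiable (sy i) (PhiW Uz).
pose w := 'd Phi z (z.2, zeta).
pose S := \sum_i ('D_e (fun x => 'D_(z.2) phi x) z.1) 0 i * pdy i lb (Phi z).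
pose T := \sum_i ('D_e phi z.1) 0 i * 'D_w (pdy i lb) (Phi z).
have EA : 'D_(z.2, zeta) (fun x => 'D_(0, e) la x) z = S + T.
  have H : has_deriv (fun x => 'D_(0, e) la x) z (z.2, zeta)
     (\sum_i (('D_(z.2) (fun x => 'D_e phi x) z.1) 0 i * pdy i lb (Phi z)
       + ('D_e phi z.1) 0 i * 'D_w (pdy i lb) (Phi z))).
    apply: (@has_deriv_near _ _ _ (fun z => \sum_i ('D_e phi z.1) 0 i * pdy i lb (Phi z))).
      by apply: (near_open oTU Uz) => x Ux; rewrite derive_vertical.
    apply: has_deriv_sum => i; apply: has_derivM.
      exact: (has_deriv_row_coord i
        (has_deriv_comp (has_deriv_fst z (z.2, zeta)) (has_deriv_self z.2 (ddphi e Uz)))).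
    exact: (has_deriv_comp (has_deriv_diff _ dP) (has_deriv_self w (dy i))).
  apply: (etrans H.2); rewrite big_split -/T; apply: (congr1 (fun a : R => a + T)).
  apply: eq_bigr => i _.
  exact: (congr1 (fun r : row => r 0 i * pdy i lb (Phi z)) (row_derive_comm _ _ Uz)).
have EB : 'D_(e, 0) la z = 'D_('D_e phi z.1, 0) lb (Phi z) + S.
  have H : has_deriv la z (e, 0) ('D_('D_e phi z.1, 0) lb (Phi z) + S).
    apply: (@has_deriv_near _ _ _ (fun z => lb (Phi z))).
      by apply: (near_open oTU Uz) => x Ux; rewrite lab.
    apply: has_deriv_eq (has_deriv_comp (Phi_deriv (e, 0) Uz) (has_deriv_self _ dlb)) _.
    rewrite /= derive0 addr0; exact: derive_pair_split.
  exact: H.2.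
have EC : 'D_w (fun x => 'D_(0, 'D_e phi z.1) lb x) (Phi z) = T.
  have H : has_deriv (fun x => 'D_(0, 'D_e phi z.1) lb x) (Phi z) w T.
    apply: (@has_deriv_near _ _ _ (fun x => \sum_i ('D_e phi z.1) 0 i * pdy i lb x)).
      apply: (near_open oW (PhiW Uz)) => x Wx.
      exact: (esym (derive_ver_sum _ (smooth_on_differentiable slb Wx))).
    by apply: has_deriv_sum => i; apply: has_derivMl; exact: has_deriv_self (dy i).
  exact: H.2.
apply: (etrans (congr2 (fun a b : R => a - b) EA EB)).
apply: esym; apply: (etrans (congr1 (fun v => 'D_v _ _ - _) (esym dPE))).
apply: (etrans (congr1 (fun a : R => a - _) EC)).
have cancel_middle (s t x : R) : t - x = s + t - (x + s) by ring.
exact: cancel_middle.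
Qed.

(** The Euler-Lagrange covector is affine in the acceleration, with linear part
    2 g, and vanishes when the acceleration is -2 G. *)
Lemma euler_lagrangeE (Q : set V) (l : V -> R) z zeta e : open Q -> smooth_on Q l ->
  (forall z, Q z -> metric l z \in unitmx) -> Q z ->
  euler_lagrange l z zeta e =
  2 * \sum_k e 0 k * (metric l z *m (zeta + 2 *: \row_i spray_coef l i z)^T) k 0.
Proof.
move=> oQ sl reg Qz; have dl := smooth_on_differentiable sl Qz.
have dy k := smooth_on_differentiable (smooth_on_derive (ey k) sl) Qz.
have [_ E1] : has_deriv (fun x => 'D_(0, e) l x) z (z.2, zeta)
    (\sum_k e 0 k * 'D_(z.2, zeta) (pdy k l) z).
  apply: (@has_deriv_near _ _ _ (fun x => \sum_i e 0 i * pdy i l x)).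
    apply: (near_open oQ Qz) => x Qx.
    exact: (esym (derive_ver_sum _ (smooth_on_differentiable sl Qx))).
  by apply: has_deriv_sum => i; apply: has_derivMl; exact: has_deriv_self (dy i).
apply: (etrans (congr2 (fun a b : R => a - b) E1 (derive_hor_sum e dl))).
rewrite -sumrB mulr_sumr; apply: eq_bigr => k _; rewrite -mulrBr mulrCA; congr (_ * _).
have EX : \sum_i z.2 0 i * pdx i (pdy k l) z = \sum_i pdy k (pdx i l) z * z.2 0 i.
  apply: eq_bigr => i _; apply: (etrans (mulrC _ _)).
  exact: (congr1 (fun a : R => a * z.2 0 i) (pdx_pdy_comm oQ i k sl Qz)).
have EY : \sum_i zeta 0 i * pdy i (pdy k l) z = 2 * \sum_i metric l z k i * zeta 0 i.
  rewrite mulr_sumr; apply: eq_bigr => i _; rewrite mxE.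
  apply: (etrans (congr1 (fun a : R => zeta 0 i * a) (pdy_comm oQ i k sl Qz))).
  have double_half (a x : R) : a * x = 2 * (2^-1 * x * a) by field.
  exact: double_half.
have ED := etrans (derive_pair_sum (z.2, zeta) (dy k)) (congr2 (fun a b : R => a + b) EX EY).
apply: (etrans (congr1 (fun a : R => a - pdx k l z) ED)).
apply: (etrans (addrAC _ _ _)).
apply: (etrans (congr1 (fun a : R => a + 2 * \sum_i metric l z k i * zeta 0 i)
  (esym (spray_coefE reg k Qz)))).
rewrite mxE.
have -> : \sum_m metric l z k m * (zeta + 2 *: \row_i spray_coef l i z)^T m 0 =
  \sum_m metric l z k m * zeta 0 m + 2 * \sum_m metric l z k m * spray_coef l m z.
  have tE m : (zeta + 2 *: \row_i spray_coef l i z)^T m 0 = zeta 0 m + 2 * spray_coef l m z.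
    by rewrite !mxE.
  rewrite mulr_sumr -big_split; apply: eq_bigr => m _; rewrite tE.
  by rewrite mulrDr (mulrCA _ 2).
have collect (a b : R) : 4 * a + 2 * b = 2 * (b + 2 * a) by ring.
exact: collect.
Qed.

(** Since g is invertible, -2 G is the only acceleration at which the
    Euler-Lagrange covector vanishes, and this characterisation is covariant. *)
Lemma spray_covariant z : TU z ->
  ('d Phi z (z.2, - 2 *: Ga z)).2 = - 2 *: Gb (Phi z).
Proof.
move=> Uz; set w := LHS.
have H (e : row) : \sum_k e 0 k * (metric lb (Phi z) *m (w + 2 *: Gb (Phi z))^T) k 0 = 0.
  have [f <-] := surj Uz e.
  have E := euler_lagrange_covariant (- 2 *: Ga z) f Uz.
  have E1 := euler_lagrangeE (- 2 *: Ga z) f oTU sla rega Uz.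
  have E2 := euler_lagrangeE w ('D_f phi z.1) oW slb regb (PhiW Uz).
  have E0 : 2 * \sum_k f 0 k * (metric la z *m (- 2 *: Ga z + 2 *: Ga z)^T) k 0 = 0.
    rewrite scaleNr addNr trmx0 mulmx0 big1 ?mulr0// => k _.
    by rewrite mxE mulr0.
  apply: (mulfI (_ : 2 != 0 :> R)); first by rewrite pnatr_eq0.
  rewrite mulr0; exact: (etrans (esym E2) (etrans (esym E) (etrans E1 E0))).
have M0 : metric lb (Phi z) *m (w + 2 *: Gb (Phi z))^T = 0.
  apply/matrixP => k j; rewrite ord1 [RHS]mxE -[RHS](H (delta_mx 0 k)).
  by rewrite sum_delta_row.
have T0 : (w + 2 *: Gb (Phi z))^T = 0.
  by rewrite -[LHS](mulKmx (regb (PhiW Uz))) M0 mulmx0.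
by apply/eqP; rewrite scaleNr -addr_eq0 -[_ + _]trmxK T0 trmx0.
Qed.

Lemma spray_covariant_row z k : TU z ->
  spray_coef lb k (Phi z) =
  \sum_i spray_coef la i z * ('D_(delta_mx 0 i) phi z.1) 0 k
  - 2^-1 * \sum_i \sum_j z.2 0 i * z.2 0 j *
     ('D_(delta_mx 0 j) (fun x => 'D_(delta_mx 0 i) phi x) z.1) 0 k.
Proof.
move=> Uz.
have E1 := congr1 snd (has_deriv_diffE (Phi_deriv (z.2, - 2 *: Ga z) Uz)).
have E := congr1 (fun r : row => r 0 k) (etrans (esym E1) (spray_covariant Uz)).
apply: solve_for_spray.
have Eq := derive2_coord_sum z.2 z.2 k oU Uz sphi.
have Es : ('D_(- 2 *: Ga z) phi z.1) 0 k =
    - 2 * \sum_i spray_coef la i z * ('D_(delta_mx 0 i) phi z.1) 0 k.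
  apply: (etrans (derive_coord_sum _ k (dphi Uz))); rewrite mulr_sumr.
  apply: eq_bigr => i _; rewrite mulrA.
  by apply: (congr1 (fun r : R => r * _)); rewrite !mxE.
apply: (etrans (congr2 (fun a b : R => a + b) (esym Eq) (esym Es))).
apply: etrans (etrans E _); first by rewrite mxE.
by rewrite !mxE.
Qed.

(** The transformation law of the coefficients dG/dy, obtained by differentiating
    that of the spray along the fibre: the quadratic term in z.2 produces the
    second derivative of phi. *)
Lemma canonic_covariant z e : TU z ->
  'D_(0, 'D_e phi z.1) Gb (Phi z) =
  'D_('D_(0, e) Ga z) phi z.1 - 'D_e (fun x => 'D_(z.2) phi x) z.1.
Proof.
move=> Uz; apply/rowP => k.
have dGb i := smooth_on_differentiable (smooth_spray_coef oW slb regb i) (PhiW Uz).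
have dGa i := smooth_on_differentiable (smooth_spray_coef oTU sla rega i) Uz.
have dc i x : U x -> differentiable (fun x => ('D_(delta_mx 0 i) phi x) 0 k) x.
  by move=> Ux; have [] := has_deriv_row_coord k (has_deriv_self 0 (ddphi (delta_mx 0 i) Ux)).
have hGa : has_deriv Ga z (0, e) (\row_i 'D_(0, e) (spray_coef la i) z).
  apply: has_deriv_rowP => j; rewrite mxE.
  by apply: has_deriv_near (has_deriv_self _ (dGa j)); apply: (near_open oTU Uz) => x _; rewrite mxE.
have hGb v : ('D_v Gb (Phi z)) 0 k = 'D_v (spray_coef lb k) (Phi z).
  have hb : has_deriv Gb (Phi z) v (\row_i 'D_v (spray_coef lb i) (Phi z)).
    apply: has_deriv_rowP => j; rewrite mxE.
    apply: has_deriv_near (has_deriv_self _ (dGb j)).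
    by apply: (near_open oW (PhiW Uz)) => x _; rewrite mxE.
  by have [_ ->] := hb; rewrite mxE.
rewrite hGb.
have L : has_deriv (fun z => spray_coef lb k (Phi z)) z (0, e)
    ('D_(0, 'D_e phi z.1) (spray_coef lb k) (Phi z)).
  apply: (has_deriv_comp _ (has_deriv_self _ (dGb k))).
  by apply: has_deriv_eq (Phi_deriv (0, e) Uz) _; rewrite /= !derive0 add0r.
have [_ <-] := L.
have d1 i : has_deriv (fun z : V => z.2 0 i) z (0, e) (e 0 i).
  exact: (has_deriv_row_coord i (has_deriv_snd z (0, e))).
have d2 (f : row -> R) : differentiable f z.1 -> has_deriv (fun z : V => f z.1) z (0, e) 0.
  move=> df; apply: (has_deriv_comp (has_deriv_fst z (0, e))).
  by split=> //; exact: derive0.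
have dcc i j : differentiable (fun x => ('D_(delta_mx 0 j) (fun x => 'D_(delta_mx 0 i) phi x) x) 0 k) z.1.
  have sij := smooth_on_derive (delta_mx 0 j) (smooth_on_derive (delta_mx 0 i) sphi).
  by have [] := has_deriv_row_coord k (has_deriv_self 0 (smooth_on_differentiable sij Uz)).
have Rg : has_deriv (fun z => \sum_i spray_coef la i z * ('D_(delta_mx 0 i) phi z.1) 0 k
  - 2^-1 * \sum_i \sum_j z.2 0 i * z.2 0 j *
     ('D_(delta_mx 0 j) (fun x => 'D_(delta_mx 0 i) phi x) z.1) 0 k) z (0, e)
  (\sum_i ('D_(0, e) (spray_coef la i) z * ('D_(delta_mx 0 i) phi z.1) 0 k
           + spray_coef la i z * 0)
  - 2^-1 * \sum_i \sum_j ((e 0 i * z.2 0 j + z.2 0 i * e 0 j) *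
     ('D_(delta_mx 0 j) (fun x => 'D_(delta_mx 0 i) phi x) z.1) 0 k
      + z.2 0 i * z.2 0 j * 0)).
  apply: has_derivB.
    apply: has_deriv_sum => i.
    exact: (has_derivM (has_deriv_self _ (dGa i)) (d2 _ (dc i _ Uz))).
  apply: has_derivMl; apply: has_deriv_sum => i; apply: has_deriv_sum => j.
  exact: (has_derivM (has_derivM (d1 i) (d1 j)) (d2 _ (dcc i j))).
have [_ ->] := has_deriv_near (near_open oTU Uz (fun x Ux => esym (spray_covariant_row k Ux))) Rg.
have EG : \sum_i ('D_(0, e) (spray_coef la i) z * ('D_(delta_mx 0 i) phi z.1) 0 k
           + spray_coef la i z * 0) = ('D_('D_(0, e) Ga z) phi z.1) 0 k.
  apply: esym; apply: (etrans (derive_coord_sum _ k (dphi Uz))).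
  apply: eq_bigr => i _; rewrite mulr0 addr0.
  apply: (congr1 (fun r : R => r * _)).
  by apply: (etrans (congr1 (fun r : row => r 0 i) hGa.2)); rewrite mxE.
have EQ : \sum_i \sum_j ((e 0 i * z.2 0 j + z.2 0 i * e 0 j) *
     ('D_(delta_mx 0 j) (fun x => 'D_(delta_mx 0 i) phi x) z.1) 0 k
      + z.2 0 i * z.2 0 j * 0) = 2 * ('D_e (fun x => 'D_(z.2) phi x) z.1) 0 k.
  have q1 := derive2_coord_sum e z.2 k oU Uz sphi.
  have q2 := derive2_coord_sum z.2 e k oU Uz sphi.
  have q3 := congr1 (fun r : row => r 0 k) (row_derive_comm z.2 e Uz).
  apply: (etrans _ (esym (mulr_natl _ 2))); rewrite mulr2n.
  apply: (etrans _ (congr2 (fun a b : R => a + b) (etrans (esym q1) q3) (esym q2))).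
  rewrite -big_split; apply: eq_bigr => i _; rewrite -big_split; apply: eq_bigr => j _ /=.
  by rewrite mulr0 addr0 mulrDl.
apply: (etrans (congr2 (fun a b : R => a - 2^-1 * b) EG EQ)).
rewrite mulrA mulVf ?pnatr_eq0// mul1r.
by rewrite [RHS]mxE; apply: (congr1 (fun r : R => _ + r)); rewrite mxE.
Qed.

End SprayCovariance.

(** * Vector fields with a prescribed value *)

Section Manifold.
Context {R : realType} {n : nat} {M : topologicalType} {A : atlas 'rV[R]_n M}.
Hypothesis hM : smooth_manifold A.
Local Notation row := 'rV[R]_n.
Local Notation V := ('rV[R]_n * 'rV[R]_n)%type.
Local Notation TM := (tangent_bundle A).
Local Notation TA := (tangent_atlas A).

Lemma chart_open_image (a : chart A) (W : set M) :
  W `<=` chart_dom a -> open W -> open (chart_coord a @` W).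
Proof.
move=> Wa oW; have [_ [_ [_ [ha _]]]] := hM.
by have [_ _ _ H] := ha a; apply/(H W Wa).
Qed.

Lemma manifold_smooth_atlas : smooth_atlas A.
Proof.
have [_ [_ [_ [ha hs]]]] := hM; split=> [a|a b]; first by have [] := ha a.
split; last exact: hs.
apply: chart_open_image; first exact: subIsetl.
by apply: openI; have [] := ha a => //; have [] := ha b.
Qed.

Let hA := manifold_smooth_atlas.
Let hTA := tangent_bundle_smooth_atlas hA.

Lemma manifold_cover (p : M) : exists a : chart A, chart_dom a p.
Proof. by have [_ [_ [+ _]]] := hM; apply. Qed.

(** In a Hausdorff manifold the inverse image of a compact subset of a chart
    image is closed, so a function supported there extends by zero. *)
Lemma compact_chart_closed (a : chart A) (K : set row) :
  compact K -> K `<=` chart_image a ->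
  closed (chart_dom a `&` chart_coord a @^-1` K).
Proof.
move=> cK Ka; have [hausM [_ [_ [ha _]]]] := hM.
have [oda oia inja _] := ha a.
have [[p0 _]|empty] := pselect (exists p : M, chart_dom a p); last first.
  rewrite (_ : _ `&` _ = set0); first exact: closed0.
  by apply/seteqP; split=> // p [ap _]; apply: empty; exists p.
pose psi (z : row) : M := xget p0 [set q | chart_dom a q /\ chart_coord a q = z].
have psiK q : chart_dom a q -> psi (chart_coord a q) = q.
  move=> aq; rewrite /psi; case: xgetP => [r _ [ar rq]|/(_ q) H].
    by apply: inja => //; exact/mem_set.
  by exfalso; apply: H.
have -> : chart_dom a `&` chart_coord a @^-1` K = psi @` K.
  apply/seteqP; split=> [q [aq Kq]|_ [z Kz <-]].
    by exists (chart_coord a q) => //; exact: psiK.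
  by have [q aq qz] := Ka z Kz; rewrite -qz psiK//; split=> //=; rewrite qz.
apply: compact_closed => //; apply: continuous_compact => //.
apply: continuous_in_subspaceT => z /set_mem /Ka[q aq <-] O /=.
rewrite psiK// nbhsE => -[Q [oQ Qq] QO].
have oi : open (chart_coord a @` (chart_dom a `&` Q)).
  by apply: chart_open_image; [exact: subIsetl|exact: openI].
apply: (near_open oi); first by exists q.
by move=> _ [r [ar Qr] <-] /=; rewrite psiK//; exact: QO.
Qed.

(** The last property says that the extension by zero is smooth at the points
    outside the chart; compact_chart_closed provides the neighbourhood. *)
Lemma manifold_bump (a : chart A) (p0 : M) : chart_dom a p0 ->
  exists rho : M -> R, [/\ rho p0 = 1,
    smooth_on (chart_image a) (local_rep a rho) &
    forall (b : chart A) p, chart_dom b p -> ~ chart_dom a p ->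
      \forall x \near chart_coord b p, local_rep b rho x = 0].
Proof.
move=> ap0; have [_ [_ [_ [ha _]]]] := hM; have [oda oia inja _] := ha a.
have [f [K [sf f1 cK Ka fK]]] := exists_bump oia (imageP (chart_coord a) ap0).
pose rho p := if `[< chart_dom a p >] then f (chart_coord a p) else 0.
exists rho; split.
- by rewrite /rho asboolT.
- apply: (smooth_on_ext oia) (smooth_on_sub (@subsetT _ _) sf).
  by move=> _ /set_mem[p ap <-]; rewrite (local_repE hA)// /rho asboolT.
move=> b p bp nap; have [odb _ _ _] := ha b.
have oO : open (chart_coord b @` (chart_dom b `&` ~` (chart_dom a `&` chart_coord a @^-1` K))).
  apply: chart_open_image; first exact: subIsetl.
  by apply: openI => //; apply: closed_openC; exact: compact_chart_closed.
apply: (near_open oO); first by exists p => //; split=> // -[].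
move=> _ [q [bq nq] <-]; rewrite (local_repE hA)// /rho.
by case: asboolP => // aq; apply: fK => Kq; apply: nq.
Qed.

(** Multiply the field with constant components v in a chart by a bump function.
    A bump function of the base point is enough, since the chart domain contains
    whole fibres. *)
Lemma exists_vector_field (a : chart TA) (u0 : TM) (v : V) : chart_dom a u0 ->
  exists X : TM -> chart TA -> V,
    [/\ vector_field X, X u0 = tangent_of_chart a u0 v &
        v.1 = 0 -> vertical_field X].
Proof.
move=> au0; have [rho [rho1 srho rhoN]] := manifold_bump (au0 : chart_dom (a : chart A) _).
pose X (u : TM) : chart TA -> V :=
  if `[< chart_dom a u >] then (fun b => rho (tb_proj u) *: tangent_of_chart a u v b)
  else (fun=> 0).
have XE u b : chart_dom a u -> X u b = rho (tb_proj u) *: tangent_of_chart a u v b.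
  by move=> au; rewrite /X asboolT.
have tX u : tangent_space TA u (X u).
  have [au|nau] := pselect (chart_dom a u); last first.
    by rewrite /X asboolF//; split=> // b c _ _; rewrite linear0.
  rewrite /X asboolT//; apply: tangent_spaceZ.
  exact: (tangent_of_chartP hTA).
have fX : vector_field X.
  split=> // b; apply: smooth_on_local => _ [u bu <-].
  have [au|nau] := pselect (chart_dom a u).
    have [oba sba] := hTA.2 b a; have [_ sab] := hTA.2 a b.
    have [oab _] := hTA.2 a b.
    exists (overlap b a); first exact: mem_overlap.
    have ec := @coordinates_pair_row R n.
    have s1 : smooth_on (overlap b a) (fun z : V => local_rep (A := A) a rho (transition b a z).1).
      have oaa : open (chart_image (A := A) a) by have [_ [_ [_ [ha _]]]] := hM; have [] := ha a.
      apply: (smooth_on_comp oba (@coordinates_row R n) _ srho).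
        by move=> _ [w [bw aw] <-]; rewrite (transitionE hTA)//; exists (tb_proj w).
      exact: (smooth_on_linr oba (@has_deriv_fst _ _ _) sba).
    have s2 : smooth_on (overlap a b) (fun z : V => 'D_v (transition a b) z).
      exact: smooth_on_derive.
    have sub z : overlap b a z -> overlap a b (transition b a z).
      exact: (overlap_transition hTA).
    have s3 : smooth_on (overlap b a) (fun z : V =>
       ((\row_i (local_rep (A := A) a rho (transition b a z).1 *
                 ('D_v (transition a b) (transition b a z)).1 0 i)),
        (\row_i (local_rep (A := A) a rho (transition b a z).1 *
                 ('D_v (transition a b) (transition b a z)).2 0 i)))).
      have s21 i : smooth_on (overlap a b) (fun z : V => ('D_v (transition a b) z).1 0 i).
        apply: (smooth_on_coord oab).
        exact: (smooth_on_linr oab (@has_deriv_fst _ _ _) s2).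
      have s22 i : smooth_on (overlap a b) (fun z : V => ('D_v (transition a b) z).2 0 i).
        apply: (smooth_on_coord oab).
        exact: (smooth_on_linr oab (@has_deriv_snd _ _ _) s2).
      apply: (smooth_on_pair oba); apply: (smooth_on_row oba) => i.
        exact: (smooth_onM oba s1 (smooth_on_comp oba ec sub (s21 i) sba)).
      exact: (smooth_onM oba s1 (smooth_on_comp oba ec sub (s22 i) sba)).
    apply: (smooth_on_ext oba) s3 => _ /set_mem[w [bw aw] <-].
    rewrite (local_repE hTA)// XE// (transitionE hTA)// /= (local_repE hA)//.
    rewrite tangent_of_chart_in// -deriveE; last first.
      exact: (transition_differentiable hTA (mem_overlap aw bw)).
    by apply: injective_projections; apply/rowP => i; rewrite !mxE.
  have [W [oW Wp] WN] : exists2 W : set row, open W /\ W (chart_coord (b : chart A) (tb_proj u)) &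
      forall x, W x -> local_rep (A := A) b rho x = 0.
    have := rhoN b (tb_proj u) bu nau; rewrite /prop_near1 nbhsE => -[W [oW Wp] WN].
    by exists W.
  have [obb _] := hTA.2 b b.
  exists (overlap b b `&` (fst : V -> row) @^-1` W).
    by split; [exact: mem_overlap|exact: Wp].
  have oO : open (overlap b b `&` (fst : V -> row) @^-1` W).
    by apply: openI => //; exact: open_fst.
  apply: (smooth_on_ext oO) (smooth_on_cst oO (0 : V)) => _ /set_mem[[w [bw _] <-] /= Ww].
  rewrite (local_repE hTA)//; have [aw|naw] := pselect (chart_dom a w).
    by rewrite XE//; have := WN _ Ww; rewrite (local_repE hA)// => ->; rewrite scale0r.
  by rewrite /X asboolF.
exists X; split=> //.
  rewrite /X asboolT// rho1; apply/funext => b; exact: scale1r.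
move=> v0; split=> // u; have [au|nau] := pselect (chart_dom a u).
  by apply/(vertical_spaceP hA _ au); rewrite XE// tangent_of_chart_self//= v0 scaler0.
split=> // c b cu bu; rewrite /X asboolF//; exact: linear0.
Qed.

End Manifold.

(** * Nonlinear connections and their coefficients *)

Section Connections.
Context {R : realType} {n : nat} {M : topologicalType} {A : atlas 'rV[R]_n M}.
Hypothesis hM : smooth_manifold A.
Local Notation row := 'rV[R]_n.
Local Notation V := ('rV[R]_n * 'rV[R]_n)%type.
Local Notation TM := (tangent_bundle A).
Local Notation TA := (tangent_atlas A).

Let hA := manifold_smooth_atlas hM.
Let hTA := tangent_bundle_smooth_atlas hA.

Lemma tangent_space_sum (I : finType) (u : TM) (x : I -> R) (H : I -> chart TA -> V) :
  (forall i, tangent_space TA u (H i)) ->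
  tangent_space TA u (fun b => \sum_i x i *: H i b).
Proof.
move=> tH; split=> [b bu|b c bu cu].
  by rewrite big1// => i _; rewrite (tH i).1// scaler0.
by rewrite linear_sum; apply: eq_bigr => i _; rewrite linearZ /= ((tH i).2 b c).
Qed.

Section Connection.
Variable N : TM -> set (chart TA -> V).
Hypothesis hN : nonlinear_connection N.

Lemma connection_tangent u w : N u w -> tangent_space TA u w.
Proof.
move=> Nw; have [a au] := manifold_cover hM (tb_proj u).
have [W [X [_ Wu _ H]]] := hN.1 (a : chart TA) u au.
by have [_ NE] := H u au Wu; move: Nw; rewrite NE => -[].
Qed.

(** A fibre of a connection is a linear subspace: it is locally a span. *)
Lemma connection_sum (I : finType) u (x : I -> R) (H : I -> chart TA -> V) :
  (forall i, N u (H i)) -> N u (fun b => \sum_i x i *: H i b).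
Proof.
move=> NH; have [a au] := manifold_cover hM (tb_proj u).
have [W [X [_ Wu _ HX]]] := hN.1 (a : chart TA) u au.
have [_ NE] := HX u au Wu.
have tH i := connection_tangent (NH i).
have cH i : exists c : 'I_n -> R, H i (a : chart TA) = \sum_j c j *: X j (chart_coord (a : chart TA) u).
  by have := NH i; rewrite NE => -[].
rewrite NE; split; first exact: tangent_space_sum.
exists (fun j => \sum_i x i * sval (cid (cH i)) j).
under eq_bigr do rewrite (svalP (cid (cH _))) scaler_sumr.
rewrite exchange_big; apply: eq_bigr => j _; rewrite scaler_suml.
by apply: eq_bigr => i _; rewrite scalerA.
Qed.

Lemma horizontal_projP u w : tangent_space TA u w ->
  N u (horizontal_proj N u w) /\ vertical_space u (w - horizontal_proj N u w).
Proof.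
move=> tw; have [[h v] [[/= Nh Vv wE] _]] := hN.2 u w tw.
rewrite /horizontal_proj; case: xgetP => [y _ //|/(_ h) H].
by exfalso; apply: H; split=> //; rewrite wE (addrC h) addrK.
Qed.

(** The difference of h and k is vertical, so h = k + (h - k) and h = h + 0 are
    two decompositions of h. *)
Lemma horizontal_eq (a : chart TA) u h k : chart_dom a u -> N u h -> N u k ->
  (h a).1 = (k a).1 -> h = k.
Proof.
move=> au Nh Nk hk; have th := connection_tangent Nh; have tk := connection_tangent Nk.
have [hv [_ U]] := hN.2 u h th.
have E1 : hv = (h, 0).
  apply: U; split=> //=; last by rewrite addr0.
  apply/(vertical_spaceP hA _ au); split=> //.
  by split=> // b c _ _; rewrite linear0.
have E2 : hv = (k, h - k).
  apply: U; split=> //=; last by rewrite addrC subrK.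
  apply/(vertical_spaceP hA _ au); split; first exact: tangent_spaceB.
  by rewrite -[(h - k) a]/(h a - k a) /= hk subrr.
by move: E1; rewrite E2 => -[].
Qed.

Lemma horizontal_proj_fst (a : chart TA) u w : chart_dom a u ->
  tangent_space TA u w -> (horizontal_proj N u w a).1 = (w a).1.
Proof.
move=> au tw; have [_ /(vertical_spaceP hA _ au)[_]] := horizontal_projP tw.
rewrite -[(w - _) a]/(w a - horizontal_proj N u w a) /= => /eqP.
by rewrite subr_eq0 => /eqP.
Qed.

Definition conn_matrix (a : chart TA) (u : TM) : 'M[R]_n :=
  \matrix_(i, j) conn_coef N a i j u.

(** The n horizontal lifts of the coordinate vectors span the fibre, and their
    vertical components are the coefficients of the connection. In particular
    these coefficients determine the connection. *)
Lemma connectionE (a : chart TA) u w : chart_dom a u ->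
  N u w <-> tangent_space TA u w /\ graph_of (conn_matrix a u) (w a).
Proof.
move=> au.
pose H (j : 'I_n) := horizontal_proj N u (tangent_of_chart a u (ex j)).
have tH j : tangent_space TA u (tangent_of_chart a u (ex j : V)).
  exact: (tangent_of_chartP hTA).
have NH j : N u (H j) := (horizontal_projP (tH j)).1.
have H1 j : (H j a).1 = delta_mx 0 j.
  by rewrite horizontal_proj_fst// (tangent_of_chart_self hTA).
pose w' b := \sum_j (w a).1 0 j *: H j b.
have Nw' : N u w' by exact: connection_sum.
have w'1 : (w' a).1 = (w a).1.
  rewrite fst_sum [RHS]row_sum_delta; apply: eq_bigr => j _.
  by rewrite /= H1.
have w'2 i : (w' a).2 0 i = - \sum_j conn_matrix a u i j * (w a).1 0 j.
  rewrite snd_sum summxE -sumrN; apply: eq_bigr => j _.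
  by rewrite [conn_matrix _ _ _ _]mxE /conn_coef -/(H j) /= mxE mulNr opprK mulrC.
split=> [Nw|[tw gw]].
  split; first exact: connection_tangent.
  have ww' : w = w' by apply: (horizontal_eq au).
  by move=> i /=; rewrite {1}ww'; exact: w'2.
suff -> : w = w' by [].
apply: (tangent_space_eq au tw (connection_tangent Nw') _).
apply: injective_projections; first by [].
by apply/rowP => i; rewrite gw w'2.
Qed.

End Connection.

Section LagrangeSpace.
Variable L : TM -> R.
Hypothesis hL : lagrange_space L.
Local Notation lag a := (local_rep (A := TA) a L).

Lemma lagrangian_smooth (a : chart TA) : smooth_on (chart_image a) (lag a).
Proof. exact: hL.1. Qed.

Lemma chart_image_open (a : chart TA) : open (chart_image a).
Proof. by rewrite -overlap_refl; have [] := hTA.2 a a. Qed.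

Lemma metric_unit (a : chart TA) z : chart_image a z -> metric (lag a) z \in unitmx.
Proof.
move=> [u au <-]; rewrite -row_free_unit /row_free; apply/eqP.
exact: hL.2.
Qed.

Let im (a : chart TA) u : chart_dom a u -> chart_image a (chart_coord a u).
Proof. by move=> au; exists u. Qed.

Lemma horizontal_proj_graph N (hN : nonlinear_connection N) (a : chart TA) u w :
  chart_dom a u -> tangent_space TA u w ->
  graph_of (conn_matrix N a u) (horizontal_proj N u w a).
Proof.
by move=> au tw; have [] := (connectionE hN _ au).1 (horizontal_projP hN tw).1.
Qed.

(** Fields with arbitrary values at a point turn the condition on vector fields
    into an equation between the coefficients at that point. *)
Lemma lagrangian_horizontalP N : nonlinear_connection N ->
  lagrangian_horizontal L N <->
  forall (a : chart TA) u, chart_dom a u ->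
    lagrangian_eq (lag a) (chart_coord a u) (conn_matrix N a u).
Proof.
move=> hN; split=> [lN a u au k j|H X Y [tX _] [tY _] a u au].
  have [X [fX Xu _]] := exists_vector_field hM (ex j : V) au.
  have [Y [fY Yu _]] := exists_vector_field hM (ex k : V) au.
  have := lN X Y fX fY a u au.
  have gX := horizontal_proj_graph hN au (fX.1 u).
  have gY := horizontal_proj_graph hN au (fY.1 u).
  have X1 : (horizontal_proj N u (X u) a).1 = delta_mx 0 j.
    rewrite (horizontal_proj_fst hN au (fX.1 u)) Xu.
    by rewrite (tangent_of_chart_self hTA).
  have Y1 : (horizontal_proj N u (Y u) a).1 = delta_mx 0 k.
    rewrite (horizontal_proj_fst hN au (fY.1 u)) Yu.
    by rewrite (tangent_of_chart_self hTA).
  have E := cartan_two_form_graph (@chart_image_open a) (@lagrangian_smooth a) (im au) gX gY.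
  move=> /(etrans (esym E)).
  rewrite X1 Y1 => {}E.
  move: E; under eq_bigr => p _.
    under eq_bigr do rewrite -mulrA.
    rewrite -mulr_sumr sum_delta_row; over.
  rewrite sum_delta_row => /eqP; rewrite mulf_eq0 invr_eq0 pnatr_eq0 /= subr_eq0.
  by move/eqP.
have E := cartan_two_form_graph (@chart_image_open a) (@lagrangian_smooth a) (im au)
  (horizontal_proj_graph hN au (tX u)) (horizontal_proj_graph hN au (tY u)).
apply: (etrans E); rewrite big1 ?mulr0// => k _; rewrite big1// => j _.
by rewrite (H a u au k j) subrr mulr0.
Qed.

Let vcomp_local (X : TM -> chart TA -> V) (a : chart TA) (i : 'I_n) : V -> R :=
  local_rep (A := TA) a (vcomp X a i).

Lemma vcomp_differentiable X a i u : vector_field X -> chart_dom a u ->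
  differentiable (vcomp_local X a i) (chart_coord a u).
Proof.
move=> [_ sX] au.
have dX := smooth_on_differentiable (sX a) (im au).
have H := has_deriv_row_coord i (has_deriv_comp (has_deriv_self 0 dX) (has_deriv_snd _ _)).
apply: (differentiable_near _ H.1).
apply: (near_open (@chart_image_open a) (im au)) => _ [w aw <-].
by rewrite /vcomp_local !(local_repE hTA).
Qed.

Lemma nabla_metricE N (X Y : TM -> chart TA -> V) (a : chart TA) u :
  vector_field X -> vector_field Y -> chart_dom a u ->
  nabla_metric L N a X Y u = \sum_i \sum_j vcomp X a i u * vcomp Y a j u *
   ('D_(tb_vec u a, - 2 *: \row_i spray_coef (lag a) i (chart_coord a u))
       (fun x => metric (lag a) x i j) (chart_coord a u)
     - ((metric (lag a) (chart_coord a u) *m conn_matrix N a u) i j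
        + (metric (lag a) (chart_coord a u) *m conn_matrix N a u) j i)).
Proof.
move=> fX fY au.
set S := (tb_vec u a, _); set z := chart_coord a u.
have SE : canonic_semispray L u a = S by rewrite /canonic_semispray asboolT.
have dX i := vcomp_differentiable i fX au.
have dY i := vcomp_differentiable i fY au.
have XE i : vcomp_local X a i z = vcomp X a i u by exact: (local_repE hTA).
have YE i : vcomp_local Y a i z = vcomp Y a i u by exact: (local_repE hTA).
have E := nabla_metric_local (@chart_image_open a) (@lagrangian_smooth a)
  (conn_matrix N a u) S (im au) dX dY.
have D (Z : TM -> chart TA -> V) i : differentiable (vcomp_local Z a i) z ->
    vcomp (dyn_cov_deriv L N Z) a i u =
    'D_S (vcomp_local Z a i) z + \sum_m vcomp_local Z a m z * conn_matrix N a u i m.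
  move=> dZ; rewrite /vcomp /dyn_cov_deriv asboolT//= mxE /field_apply SE.
  apply: (congr2 (fun a b : R => a + b)); first exact: esym (deriveE _ dZ).
  apply: eq_bigr => m _; rewrite mxE.
  by apply: (congr1 (fun r : R => r * _)); apply: esym; exact: (local_repE hTA).
have F : field_apply (canonic_semispray L) a (metric_apply L a X Y) u =
    'D_S (fun x => \sum_i \sum_j metric (lag a) x i j * vcomp_local X a i x * vcomp_local Y a j x) z.
  have dm i j := smooth_on_differentiable (smooth_metric (@chart_image_open a) (@lagrangian_smooth a) i j) (im au).
  have H := has_deriv_sum (index_enum 'I_n) (fun i => has_deriv_sum (index_enum 'I_n) (fun j =>
    has_derivM (has_derivM (has_deriv_self S (dm i j)) (has_deriv_self S (dX i)))
      (has_deriv_self S (dY j)))).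
  have nE : {near z, (fun x => \sum_i \sum_j metric (lag a) x i j * vcomp_local X a i x
      * vcomp_local Y a j x) =1 local_rep (A := TA) a (metric_apply L a X Y)}.
    apply: (near_open (@chart_image_open a) (im au)) => _ [w aw <-].
    rewrite (local_repE hTA)//; apply: eq_bigr => i _; apply: eq_bigr => j _.
    by rewrite /vcomp_local !(local_repE hTA).
  have H' := has_deriv_near nE H.
  rewrite /field_apply SE; exact: (etrans (has_deriv_diffE H') (esym H.2)).
rewrite /nabla_metric; apply: (etrans (congr1 (fun r : R => r - _ - _) F)).
apply: (etrans _ (etrans E _)).
  apply: (congr2 (fun r s : R => _ - r - s)).
    apply: eq_bigr => i _; apply: eq_bigr => j _.
    by rewrite (D X i (dX i)) YE.
  apply: eq_bigr => i _; apply: eq_bigr => j _.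
  by rewrite (D Y j (dY j)) XE.
by apply: eq_bigr => i _; apply: eq_bigr => j _; rewrite XE YE.
Qed.

(** As for the Lagrangian condition, with vertical fields that take the values
    d/dy^k and d/dy^j at a point. *)
Lemma metric_parallelP N :
  metric_parallel L N <->
  forall (a : chart TA) u, chart_dom a u ->
    parallel_eq (lag a) (chart_coord a u) (conn_matrix N a u).
Proof.
split=> [pN a u au k j|H X Y [fX _] [fY _] a u au]; last first.
  rewrite nabla_metricE// big1// => i _; rewrite big1// => j _.
  by rewrite (H a u au i j) subrr mulr0.
have ey1 i : (ey i : V).1 = 0 by [].
have [X [fX Xu vX]] := exists_vector_field hM (ey k : V) au.
have [Y [fY Yu vY]] := exists_vector_field hM (ey j : V) au.
have vcX i : vcomp X a i u = (delta_mx 0 k : row) 0 i.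
  by rewrite /vcomp Xu (tangent_of_chart_self hTA).
have vcY i : vcomp Y a i u = (delta_mx 0 j : row) 0 i.
  by rewrite /vcomp Yu (tangent_of_chart_self hTA).
have E := nabla_metricE N fX fY au.
have := pN X Y (vX (ey1 k)) (vY (ey1 j)) a u au.
move=> /(etrans (esym E)) {}E; move: E.
under eq_bigr => p _.
  under eq_bigr do rewrite vcX vcY -mulrA.
  rewrite -mulr_sumr sum_delta_row; over.
by rewrite sum_delta_row => /subr0_eq.
Qed.

End LagrangeSpace.
End Connections.

(** * The canonic connection *)

Section CanonicConnection.
Context {R : realType} {n : nat} {M : topologicalType} {A : atlas 'rV[R]_n M}.
Hypothesis hM : smooth_manifold A.
Local Notation row := 'rV[R]_n.
Local Notation V := ('rV[R]_n * 'rV[R]_n)%type.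
Local Notation TM := (tangent_bundle A).
Local Notation TA := (tangent_atlas A).
Variable L : TM -> R.
Hypothesis hL : lagrange_space L.
Local Notation lag a := (local_rep (A := TA) a L).

Let hA := manifold_smooth_atlas hM.
Let hTA := tangent_bundle_smooth_atlas hA.

Definition spray_row (a : chart TA) (z : V) : row :=
  \row_i spray_coef (lag a) i z.

(** The equation is imposed in every chart, which makes the definition visibly
    independent of choices; canonic_space_chart shows that one chart suffices. *)
Definition canonic_space (u : TM) : set (chart TA -> V) :=
  [set w | tangent_space TA u w /\ forall a : chart TA, chart_dom a u ->
     (w a).2 = - 'D_(0, (w a).1) (spray_row a) (chart_coord a u)].

Let im (a : chart TA) u : chart_dom a u -> chart_image a (chart_coord a u).
Proof. by move=> au; exists u. Qed.

Lemma spray_row_smooth (a : chart TA) : smooth_on (chart_image a) (spray_row a).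
Proof.
apply: (smooth_on_row (@chart_image_open _ _ _ _ hM a)) => i.
exact: (smooth_spray_coef (@chart_image_open _ _ _ _ hM a) (@lagrangian_smooth _ _ _ _ _ hL a)
  (@metric_unit _ _ _ _ _ hL a)).
Qed.

(** Compare the law of change of the components of a vector tangent to the tangent
    bundle with that of the coefficients dG/dy: both contain the same second
    derivative of the transition. *)
Lemma canonic_space_chart (a : chart TA) u w : chart_dom a u ->
  tangent_space TA u w ->
  (w a).2 = - 'D_(0, (w a).1) (spray_row a) (chart_coord a u) -> canonic_space u w.
Proof.
move=> au tw wa; split; first exact: tw.
move=> b bu.
have [oab sab] := hA.2 a b; have [oTab sTab] := hTA.2 a b.
have ovE : (fst : V -> row) @^-1` overlap (A := A) a b = overlap (A := TA) a b.
  by rewrite tangent_bundle_overlap.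
have sub z : overlap (A := TA) a b z -> chart_image a z.
  by move=> [v [av _] <-]; exists v.
have PhiE (z : V) : overlap (A := A) a b z.1 ->
    (transition (A := A) a b z.1, 'd (transition (A := A) a b) (z.1) z.2) = transition (A := TA) a b z.
  by move=> Uz; rewrite (tangent_bundle_transition hA)// -ovE.
have PhiW (z : V) : overlap (A := A) a b z.1 -> chart_image b
    (transition (A := A) a b z.1, 'd (transition (A := A) a b) (z.1) z.2).
  move=> Uz; rewrite PhiE//; have : overlap (A := TA) a b z by rewrite -ovE.
  by move=> [v [av bv] <-]; rewrite (transitionE hTA)//; exists v.
have lab (z : V) : overlap (A := A) a b z.1 -> lag a z = lag b
    (transition (A := A) a b z.1, 'd (transition (A := A) a b) (z.1) z.2).
  by move=> Uz; rewrite PhiE// (local_rep_change hTA)// -ovE.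
have sla : smooth_on ((fst : V -> row) @^-1` overlap (A := A) a b) (lag a).
  by rewrite ovE; apply: smooth_on_sub sub (@lagrangian_smooth _ _ _ _ _ hL a).
have rega (z : V) : overlap (A := A) a b z.1 -> metric (lag a) z \in unitmx.
  by move=> Uz; apply: (metric_unit hL); apply: sub; rewrite -ovE.
have surj x : overlap (A := A) a b x -> forall w, exists e, 'D_e (transition (A := A) a b) x = w.
  move=> [p [ap bp] <-] y.
  exists ('d (transition (A := A) b a) (chart_coord (b : chart A) p) y).
  rewrite (deriveE _ (transition_differentiable hA (mem_overlap ap bp))).
  by rewrite (diff_transition_comp hA)// (diff_transition_refl hA).
have Uz : overlap (A := A) a b (chart_coord (a : chart TA) u).1.
  by exists (tb_proj u).
pose phi := transition (A := A) a b; pose z := chart_coord (a : chart TA) u.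
have PT : (phi z.1, 'd phi (z.1) z.2) = chart_coord (b : chart TA) u.
  exact: (etrans (PhiE z Uz) (transitionE hTA b au)).
have C0 := canonic_covariant oab (@chart_image_open _ _ _ _ hM b) sab sla
  (@lagrangian_smooth _ _ _ _ _ hL b) PhiW lab rega (@metric_unit _ _ _ _ _ hL b) surj
  (w a).1 (z := z) Uz.
have C : 'D_(0, 'D_((w a).1) phi z.1) (spray_row b) (chart_coord (b : chart TA) u) =
    'D_('D_(0, (w a).1) (spray_row a) z) phi z.1 - 'D_((w a).1) (fun x => 'D_(z.2) phi x) z.1.
  exact: (etrans (congr1 (fun q => 'D_(0, 'D_((w a).1) phi z.1) (spray_row b) q) (esym PT)) C0).
have wb : w b = 'd (transition (A := TA) a b) z (w a) := tw.2 a b au bu.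
have wT := etrans wb (transition_deriv hA (w a) au bu).
apply: (etrans (congr1 snd wT)).
apply: (etrans _ (esym (congr1 (fun v : V => - 'D_(0, v.1) (spray_row b) (chart_coord (b : chart TA) u)) wT))).
apply: (etrans _ (esym (congr1 -%R C))); rewrite opprB.
apply: (congr1 (fun r => 'D_((w a).1) (fun x => 'D_(z.2) phi x) z.1 + r)).
apply: (etrans (congr1 (fun r => 'D_r phi z.1) wa)).
have dt := transition_differentiable hA Uz.
apply: (etrans (deriveE _ dt)); apply: (etrans (linearN _ _)).
exact: (congr1 -%R (esym (deriveE _ dt))).
Qed.

Definition canonic_lift (a : chart TA) (z : V) (x : row) : V :=
  (x, - 'D_(0, x) (spray_row a) z).

Lemma canonic_space_lift (a : chart TA) u x : chart_dom a u ->
  canonic_space u (tangent_of_chart a u (canonic_lift a (chart_coord a u) x)).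
Proof.
move=> au; apply: (canonic_space_chart au); first exact: (tangent_of_chartP hTA).
by rewrite (tangent_of_chart_self hTA).
Qed.

Lemma canonic_lift_sum (a : chart TA) z x : chart_image a z ->
  canonic_lift a z x = \sum_i x 0 i *: canonic_lift a z (delta_mx 0 i).
Proof.
move=> az; have dG := smooth_on_differentiable (@spray_row_smooth a) az.
apply: injective_projections; rewrite ?fst_sum ?snd_sum /=; first exact: row_sum_delta.
rewrite (deriveE _ dG).
have -> : (0, x) = \sum_i x 0 i *: ((0, delta_mx 0 i) : V).
  apply: injective_projections; rewrite ?fst_sum ?snd_sum /=; last exact: row_sum_delta.
  by rewrite big1// => i _; rewrite scaler0.
rewrite linear_sum -sumrN; apply: eq_bigr => i _.
by rewrite linearZ /= (deriveE _ dG) scalerN.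
Qed.

Lemma canonic_spaceE (a : chart TA) u w : chart_dom a u -> canonic_space u w ->
  w a = canonic_lift a (chart_coord a u) (w a).1.
Proof.
by move=> au [tw H]; apply: injective_projections => //=; exact: H.
Qed.

(** The spanning fields are the lifts of the coordinate vectors. *)
Lemma canonic_distribution : Defs.distribution (A := TA) n canonic_space.
Proof.
move=> a u au; exists (chart_image a), (fun i z => canonic_lift a z (delta_mx 0 i)).
have oI := @chart_image_open _ _ _ _ hM a.
split=> //; first exact: im.
  move=> i; apply: (smooth_on_pair oI); first exact: (smooth_on_cst oI (delta_mx 0 i : row)).
  have sd := smooth_on_derive (0, delta_mx 0 i) (@spray_row_smooth a).
  apply: (smooth_on_rowP oI) => j.
  apply: (smooth_on_ext oI) (smooth_onN oI (smooth_on_coord oI 0 j sd)) => z _.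
  by rewrite mxE.
move=> q aq _; split=> [c c0 i|].
  have := congr1 (fun v : V => v.1 0 i) c0; rewrite fst_sum summxE /= mxE => <-.
  rewrite -(sum_delta_row c i); apply: eq_bigr => j _.
  by rewrite !mxE eqxx /= eq_sym mulrC.
apply/seteqP; split=> [w Nw|w [tw [c wE]]] /=.
  split; first exact: Nw.1.
  exists (fun i => (w a).1 0 i); rewrite (canonic_spaceE aq Nw) /=.
  exact: (canonic_lift_sum _ (im aq)).
apply: (canonic_space_chart aq tw).
pose x : row := \row_i c i.
have wx : w a = canonic_lift a (chart_coord a q) x.
  rewrite wE (canonic_lift_sum _ (im aq)); apply: eq_bigr => i _.
  by rewrite mxE.
by rewrite wx.
Qed.

Lemma canonic_nonlinear_connection : nonlinear_connection canonic_space.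
Proof.
split; first exact: canonic_distribution.
move=> u w tw; have [a au] := manifold_cover hM (tb_proj u).
pose h := tangent_of_chart (a : chart TA) u (canonic_lift a (chart_coord (a : chart TA) u) (w a).1).
have Nh : canonic_space u h by exact: canonic_space_lift.
have ha : h a = canonic_lift a (chart_coord (a : chart TA) u) (w a).1.
  exact: (tangent_of_chart_self hTA).
exists (h, w - h); split=> [|[h' v'] [/= Nh' Vv' wE]].
  split=> //=; last by rewrite addrC subrK.
  apply/(vertical_spaceP hA (a := a)) => //; split; first exact: tangent_spaceB Nh.1.
  by rewrite -[(w - h) a]/(w a - h a) ha /= subrr.
have h'h : h' = h.
  apply: (tangent_space_eq (a := a : chart TA) au Nh'.1 Nh.1).
  rewrite ha (canonic_spaceE (a := a) au Nh'); congr canonic_lift.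
  have [_ v'0] := (vertical_spaceP hA (a := a) v' au).1 Vv'.
  by rewrite wE -[(h' + v') a]/(h' a + v' a) /= v'0 addr0.
by rewrite -h'h wE (addrC h') addrK.
Qed.

(** The horizontal projection of d/dx^j is its lift, whose vertical component is
    minus the derivative of G along the fibre. *)
Lemma canonic_connection_exists : canonic_connection L canonic_space.
Proof.
split=> [|a u au i j]; first exact: canonic_nonlinear_connection.
have tw : tangent_space TA u (tangent_of_chart a u (ex j : V)).
  exact: (tangent_of_chartP hTA).
have [Nh _] := horizontal_projP canonic_nonlinear_connection tw.
have h1 := horizontal_proj_fst hM canonic_nonlinear_connection au tw.
rewrite (tangent_of_chart_self hTA) // in h1.
have dG := smooth_on_differentiable (@spray_row_smooth a) (im au).
rewrite /conn_coef (canonic_spaceE au Nh) h1 /= mxE opprK.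
have H := has_deriv_row_coord i (has_deriv_self (ey j) dG).
apply: (etrans (esym H.2)); apply: near_eq_derive.
by apply: (near_open (@chart_image_open _ _ _ _ hM a) (im au)) => x _; rewrite mxE.
Qed.

Lemma canonic_conn_matrix N (a : chart TA) u : canonic_connection L N ->
  chart_dom a u -> conn_matrix N a u = canonic_matrix (lag a) (chart_coord a u).
Proof. by move=> [_ H] au; apply/matrixP => i j; rewrite !mxE H. Qed.

End CanonicConnection.

(** * Existence and uniqueness *)

Theorem theorem3p1 (R : realType) (n : nat) (M : topologicalType)
    (A : atlas 'rV[R]_n M) (hM : smooth_manifold A)
    (L : tangent_bundle A -> R) (hL : lagrange_space L) :
  (exists N, canonic_connection L N) /\
  (forall N, canonic_connection L N ->
     unique (fun N' => [/\ nonlinear_connection N', lagrangian_horizontal L N' &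
                           metric_parallel L N']) N).
Proof.
split; first by exists (canonic_space L); exact: canonic_connection_exists.
move=> N cN; have hN := cN.1.
have im (a : chart (tangent_atlas A)) u : chart_dom a u -> chart_image a (chart_coord a u).
  by move=> au; exists u.
have lagN (a : chart (tangent_atlas A)) u (au : chart_dom a u) :=
  canonic_lagrangian_eq (@chart_image_open _ _ _ _ hM a) (@lagrangian_smooth _ _ _ _ _ hL a)
    (@metric_unit _ _ _ _ _ hL a) (im a u au).
have parN (a : chart (tangent_atlas A)) u (au : chart_dom a u) :=
  canonic_parallel_eq (@chart_image_open _ _ _ _ hM a) (@lagrangian_smooth _ _ _ _ _ hL a)
    (@metric_unit _ _ _ _ _ hL a) (im a u au).
split.
  split=> //.
    by apply/(lagrangian_horizontalP hM hL hN) => a u au; rewrite (canonic_conn_matrix cN au); exact: lagN.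
  by apply/(metric_parallelP hM hL) => a u au; rewrite (canonic_conn_matrix cN au); exact: parN.
move=> N' [hN' /(lagrangian_horizontalP hM hL hN') lN' /(metric_parallelP hM hL) pN'].
apply/funext => u; have [a au] := manifold_cover hM (tb_proj u).
(* both coefficient matrices solve the two equations of connection_matrix_unique *)
have E : conn_matrix N a u = conn_matrix N' a u.
  rewrite (canonic_conn_matrix (a := a) cN au).
  exact: (connection_matrix_unique (@metric_unit _ _ _ _ _ hL a) (im a u au)
    (lagN a u au) (parN a u au) (lN' a u au) (pN' a u au)).
have NE w := connectionE hM hN (a := a) w au.
have NE' w := connectionE hM hN' (a := a) w au.
by apply/seteqP; split=> w => [/NE|/NE'] [tw gw]; [apply/NE'|apply/NE]; rewrite ?E // -?E.
Qed.
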